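(* Let $S$ and $T$ be sentences of $\mathcal{L}_{\omega_1\omega}$ (possibly in different countable languages). If $\Phi:\mathrm{Mod}(T)\to\mathrm{Mod}(S)$ is a faithful Borel embedding and $T$ has unbounded Scott spectral gaps, then $S$ has unbounded Scott spectral gaps.
   Context: $\mathrm{Mod}(T)$ is the Polish space of structures with domain $\mathbb{N}$ satisfying $T$. A Borel embedding (reduction) $\Phi:\mathrm{Mod}(T)\to\mathrm{Mod}(S)$ is a Borel map such that $\mathcal{A}\cong\mathcal{B}\iff\Phi(\mathcal{A})\cong\Phi(\mathcal{B})$; it is faithful if the closure under isomorphism of the image of every Borel set is Borel (equivalently, the isomorphism-closure of the image of $\Phi$ is Borel). The Scott rank $\mathrm{SR}(\mathcal{A})$ of a countable structure is the least $\gamma$ such that $\mathcal{A}$ has a $\Pi_{\gamma+1}$ Scott sentence (a sentence whose countable models are exactly the copies of $\mathcal{A}$), where $\Pi_\gamma$ is the usual infinitary quantifier-alternation class. A sentence $T$ has bounded Scott spectral gaps if there is a function $D:\omega_1\to\omega_1$ such that for every $\alpha<\omega_1$ and every $\Pi_\alpha$ sentence $T'$ extending $T$ (i.e. with $T'\models T$) that is satisfiable, there is a countable $\mathcal{A}\models T'$ with $\mathrm{SR}(\mathcal{A})\le D(\alpha)$; otherwise $T$ has unbounded Scott spectral gaps. *)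

(* Defs.v *)
From HB Require Import structures.
From mathcomp Require Import all_boot all_order.
From mathcomp Require Import all_classical all_reals all_analysis.

Set Implicit Arguments.
Unset Strict Implicit.
Unset Printing Implicit Defensive.

Local Open Scope classical_set_scope.

(** * Countable ordinals *)

(** [OSup f] is the least ordinal strictly above every [f i], so that the values
    of these well-founded trees are exactly the ordinals below omega_1. An
    ordinal has many notations: equality of ordinals is [oeq], not [=]. *)
Inductive ord : Type :=
| OZero
| OSup of (nat -> ord).

Fixpoint ole (a b : ord) : Prop :=
  match a with
  | OZero => True
  | OSup f => forall i,
      match b with
      | OZero => False
      | OSup g => exists j, ole (f i) (g j)
      end
  end.

Definition olt (a b : ord) : Prop :=
  match b with
  | OZero => False
  | OSup g => exists j, ole a (g j)
  end.

Definition oeq (a b : ord) : Prop := ole a b /\ ole b a.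

Definition osucc (a : ord) : ord := OSup (fun=> a).

(** * Countable languages and their structures *)

Record language : Type := Language {
  rel_sym : countType;
  fun_sym : countType;
  rel_arity : rel_sym -> nat;
  fun_arity : fun_sym -> nat }.

Record structure (L : language) : Type := MkStructure {
  dom :> Type;
  dom_inhabited : inhabited dom;
  rel_of : forall r : rel_sym L, (rel_arity r).-tuple dom -> bool;
  fun_of : forall g : fun_sym L, (fun_arity g).-tuple dom -> dom }.

Definition countable_structure (L : language) (M : structure L) : Prop :=
  countable [set: M].

Definition isomorphic (L : language) (M N : structure L) : Prop :=
  exists2 h : M -> N, bijective h &
    (forall r (x : (rel_arity r).-tuple M),
        rel_of (map_tuple h x) = rel_of x) /\
    (forall g (x : (fun_arity g).-tuple M),
        fun_of (map_tuple h x) = h (fun_of x)).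

(** * The logic L_{omega_1 omega} *)

Inductive term (L : language) (n : nat) : Type :=
| Var of 'I_n
| App (g : fun_sym L) of ('I_(fun_arity g) -> term L n).

(** [form L n] are the formulas with free variables among the [n] de Bruijn
    indices ['I_n]; a quantifier binds index [ord0] and shifts the others.
    Binary connectives are kept apart from the infinitary ones so that finitary
    formulas can be recognised syntactically. *)
Inductive form (L : language) : nat -> Type :=
| FTrue n : form L n
| FEq n of term L n & term L n : form L n
| FRel n (r : rel_sym L) of ('I_(rel_arity r) -> term L n) : form L n
| FNot n of form L n : form L n
| FAnd n of form L n & form L n : form L n
| FOr n of form L n & form L n : form L n
| FBigAnd n of (nat -> form L n) : form L n
| FBigOr n of (nat -> form L n) : form L n
| FAll n of form L n.+1 : form L n
| FEx n of form L n.+1 : form L n.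

Definition sentence (L : language) : Type := form L 0.

Section Semantics.
Context {L : language} (M : structure L).

Fixpoint eval n (e : 'I_n -> M) (t : term L n) : M :=
  match t with
  | Var i => e i
  | App g ts => fun_of [tuple eval e (ts i) | i < fun_arity g]
  end.

Definition env_cons n (x : M) (e : 'I_n -> M) : 'I_n.+1 -> M :=
  fun i => oapp e x (unlift ord0 i).

Fixpoint sat n (phi : form L n) : ('I_n -> M) -> Prop :=
  match phi in form _ n return ('I_n -> M) -> Prop with
  | FTrue _ => fun=> True
  | FEq _ t u => fun e => eval e t = eval e u
  | FRel _ r ts => fun e => rel_of [tuple eval e (ts i) | i < rel_arity r]
  | FNot _ p => fun e => ~ sat p e
  | FAnd _ p q => fun e => sat p e /\ sat q e
  | FOr _ p q => fun e => sat p e \/ sat q e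
  | FBigAnd _ p => fun e => forall i, sat (p i) e
  | FBigOr _ p => fun e => exists i, sat (p i) e
  | FAll _ p => fun e => forall x, sat p (env_cons x e)
  | FEx _ p => fun e => exists x, sat p (env_cons x e)
  end.

Definition models (phi : sentence L) : Prop :=
  sat phi (fun i : 'I_0 => match notF (ltn_ord i) with end).

End Semantics.

Definition satisfiable (L : language) (phi : sentence L) : Prop :=
  exists M : structure L, models M phi.

Definition entails (L : language) (phi psi : sentence L) : Prop :=
  forall M : structure L, models M phi -> models M psi.

(** * The classes Sigma_alpha and Pi_alpha *)

Fixpoint finitary_qf (L : language) n (phi : form L n) : Prop :=
  match phi with
  | FTrue _ | FEq _ _ _ | FRel _ _ _ => True
  | FNot _ p => finitary_qf p
  | FAnd _ p q | FOr _ p q => finitary_qf p /\ finitary_qf q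
  | FBigAnd _ _ | FBigOr _ _ | FAll _ _ | FEx _ _ => False
  end.

Fixpoint FAlls (L : language) (n k : nat) : form L (k + n) -> form L n :=
  match k return form L (k + n) -> form L n with
  | 0 => id
  | k'.+1 => fun p => FAlls (k := k') (FAll p)
  end.

Fixpoint FExs (L : language) (n k : nat) : form L (k + n) -> form L n :=
  match k return form L (k + n) -> form L n with
  | 0 => id
  | k'.+1 => fun p => FExs (k := k') (FEx p)
  end.

(** Sigma_0 = Pi_0 = finitary quantifier-free; for alpha > 0, a Sigma_alpha
    formula is a countable disjunction of formulas (exists x1 ... xk) psi with
    psi in Pi_beta for some beta < alpha, and dually for Pi_alpha. Finite
    disjunctions and conjunctions are obtained by repeating members. *)
Inductive is_Sigma (L : language) : ord -> forall n, form L n -> Prop :=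
| Sigma_qf a n (phi : form L n) :
    oeq a OZero -> finitary_qf phi -> is_Sigma a phi
| Sigma_or a n (k : nat -> nat) (b : nat -> ord)
    (psi : forall i, form L (k i + n)) :
    (forall i, olt (b i) a) -> (forall i, is_Pi (b i) (psi i)) ->
    is_Sigma a (FBigOr (fun i => FExs (psi i)))
with is_Pi (L : language) : ord -> forall n, form L n -> Prop :=
| Pi_qf a n (phi : form L n) :
    oeq a OZero -> finitary_qf phi -> is_Pi a phi
| Pi_and a n (k : nat -> nat) (b : nat -> ord)
    (psi : forall i, form L (k i + n)) :
    (forall i, olt (b i) a) -> (forall i, is_Sigma (b i) (psi i)) ->
    is_Pi a (FBigAnd (fun i => FAlls (psi i))).

(** * Scott rank and Scott spectral gaps *)

Definition scott_sentence (L : language) (M : structure L) (phi : sentence L) :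
    Prop :=
  forall N : structure L, countable_structure N ->
    (models N phi <-> isomorphic M N).

Definition has_Pi_scott_sentence (L : language) (M : structure L) (a : ord) :
    Prop :=
  exists2 phi : sentence L, is_Pi a phi & scott_sentence M phi.

Definition is_scott_rank (L : language) (M : structure L) (c : ord) : Prop :=
  has_Pi_scott_sentence M (osucc c) /\
  forall c', has_Pi_scott_sentence M (osucc c') -> ole c c'.

(** The second clause says that [D], which is given on notations, induces a
    function from omega_1 to omega_1. *)
Definition bounded_scott_spectral_gaps (L : language) (T : sentence L) : Prop :=
  exists D : ord -> ord,
    (forall a b, oeq a b -> oeq (D a) (D b)) /\
    forall (a : ord) (T' : sentence L),
      is_Pi a T' -> entails T' T -> satisfiable T' ->
      exists M : structure L,
        [/\ countable_structure M, models M T' &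
            exists2 c, is_scott_rank M c & ole c (D a)].

Definition unbounded_scott_spectral_gaps (L : language) (T : sentence L) :
    Prop :=
  ~ bounded_scott_spectral_gaps T.

(** * The space Mod(T) and Borel embeddings *)

(** The structures with domain the natural numbers, as a countable product of
    discrete spaces [bool] and [nat] with the product topology. *)
Definition nat_structure (L : language) : topologicalType :=
  (prod_topology (fun r : rel_sym L =>
     prod_topology (fun _ : (rel_arity r).-tuple nat => bool)) *
   prod_topology (fun g : fun_sym L =>
     prod_topology (fun _ : (fun_arity g).-tuple nat => nat)))%type.

Definition structure_of (L : language) (A : nat_structure L) : structure L :=
  @MkStructure L nat (inhabits 0) A.1 A.2.

(** [Mod T] carries the subspace topology. Its Borel sets are also those of any
    finer Polish topology on it generated by Borel sets. *)
Definition Mod (L : language) (T : sentence L) : topologicalType :=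
  set_type [set A : nat_structure L | models (structure_of A) T].

Definition Mod_structure (L : language) (T : sentence L) (A : Mod T) :
    structure L :=
  structure_of (set_val A).

Definition Mod_iso (L : language) (T : sentence L) (A B : Mod T) : Prop :=
  isomorphic (Mod_structure A) (Mod_structure B).

Definition borel (X : topologicalType) : set (set X) := <<s @open X >>.

Definition borel_map (X Y : topologicalType) (f : X -> Y) : Prop :=
  forall B : set Y, borel B -> borel (f @^-1` B).

Definition iso_closure (L : language) (T : sentence L) (X : set (Mod T)) :
    set (Mod T) :=
  [set B | exists2 A, X A & Mod_iso A B].

Section BorelEmbedding.
Context {LT LS : language} {T : sentence LT} {S : sentence LS}.

Definition borel_embedding (Phi : Mod T -> Mod S) : Prop :=
  borel_map Phi /\
  forall A B : Mod T, Mod_iso A B <-> Mod_iso (Phi A) (Phi B).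

Definition faithful (Phi : Mod T -> Mod S) : Prop :=
  forall X : set (Mod T), borel X -> borel (iso_closure (Phi @` X)).

End BorelEmbedding.

(* Main.v *)
Require Import Defs.
From mathcomp Require Import all_boot all_order.
From mathcomp Require Import all_classical all_reals all_analysis.

(** The sets of models of Pi_a sentences have bounded Borel rank, and conversely
    the Vaught transform (forcing with finite injections) turns an invariant Borel
    set of rank b into the models of a Pi_(1 + b) sentence. To bound the gaps of
    [T] at level [a], it remains to bound uniformly the rank of the isomorphism
    closure of Phi(Mod(T')), for all Pi_a sentences T' implying [T]. Let x range
    over codes of Pi_a classes, made invariant by the Vaught transform. The set of
    pairs (x, z) such that z lies in the closure for x is analytic, and so is its
    complement, because the closure of Phi(Mod(T)) is Borel and [Phi] is a
    reduction; by Lusin separation this set is Borel, so its sections have bounded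
    rank. Hence the closure is axiomatised by a sentence of bounded complexity,
    which has a model B of bounded Scott rank. The preimage under [Phi] of the
    isomorphism class of B is a single isomorphism class, of bounded Borel rank,
    and so has a Scott sentence of bounded complexity. Models with a finite domain
    are treated apart: they have Pi_3 Scott sentences. *)

Set Implicit Arguments.
Unset Strict Implicit.
Unset Printing Implicit Defensive.

(** * Countable ordinals *)

(** Faithfulness makes the closure of each Phi(Mod(T')) Borel, but by itself says nothing about how
    its rank varies with T', and T' may range over uncountably many sentences. A single Borel set
    having all these closures as sections removes the obstacle, because fixing a parameter in a
    Borel set changes the rank by a bounded amount. To keep that set Borel, no invariance is
    demanded of the parameter. Forcing by the empty condition is isomorphism invariant for every
    code, and it agrees with the coded set when that set is already invariant, so every point may
    serve as a parameter. This is also what makes the complement analytic: inside the closure of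
    Phi(Mod(T)), a point z lies outside the section at x exactly when some preimage of z fails the
    transform of x, and any two preimages are isomorphic because Phi is a reduction. The gap
    function of S is applied only once the level of the axiomatisation is fixed, so the bound on the
    Scott rank of B depends on the level of T' and not on T'. *)

Lemma ole_supP f b : ole (OSup f) b <-> forall i, olt (f i) b.
Proof. by case: b => [|g]; split. Qed.

Lemma ole_refl a : ole a a.
Proof. by elim: a => [|f IH] /=; [|move=> i; exists i; apply: IH]. Qed.

Lemma ole_trans b a c : ole a b -> ole b c -> ole a c.
Proof.
elim: a b c => [//|f IH] [|g] [|h] => [/(_ 0)//|/(_ 0)//|_ /(_ 0)//|].
move=> H H2 i; have [j Hj] := H i; have [k Hk] := H2 j.
by exists k; apply: IH Hj Hk.
Qed.

Lemma olt_ole_trans b a c : olt a b -> ole b c -> olt a c.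
Proof.
case: b => [//|g] [j Hj] /ole_supP /(_ j).
by case: c => [//|h] [k Hk]; exists k; apply: ole_trans Hj Hk.
Qed.

Lemma ole_olt_trans b a c : ole a b -> olt b c -> olt a c.
Proof. by case: c => [//|h] Hab [k Hk]; exists k; apply: ole_trans Hab Hk. Qed.

Lemma ole_OSup a g j : ole a (g j) -> ole a (OSup g).
Proof.
elim: a g j => [//|f IH] g j H i.
have := H i; case Eg: (g j) => [//|h] [k Hk].
by exists j; rewrite Eg; apply: IH Hk.
Qed.

Lemma oltW a b : olt a b -> ole a b.
Proof. by case: b => [//|g] [j Hj]; apply: ole_OSup Hj. Qed.

Lemma olt_succ a : olt a (osucc a).
Proof. by exists 0; apply: ole_refl. Qed.

Lemma ole_succ a b : ole a b -> ole (osucc a) (osucc b).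
Proof. by move=> H i; exists 0. Qed.

Lemma olt_OSup g j : olt (g j) (OSup g).
Proof. by exists j; apply: ole_refl. Qed.

Lemma ole_total a b : ole a b \/ olt b a.
Proof.
elim: a b => [|f IH] b; first by left.
have [H|/existsNP[i Hi]] := EM (forall i, olt (f i) b).
  by left; apply/ole_supP.
right; exists i; case: b Hi => [//|g] Hi.
apply/ole_supP => j; have [H|//] := IH i (g j).
by case: Hi; exists j.
Qed.

(** Descending strictly below [x] lands below some immediate member of any notation bounding [x];
    hence the induction on a bound [a], to which the notation [x] need not be syntactically
    related. *)
Lemma ord_min (P : ord -> Prop) a :
  P a -> exists2 c, P c & forall c', P c' -> ole c c'.
Proof.
suff: forall x, ole x a -> P x -> exists2 c, P c & forall c', P c' -> ole c c'.
  by move=> H Pa; apply: (H a) => //; apply: ole_refl.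
elim: a => [|f IH] x xa Px.
  exists x => // c' Pc'; have [//|] := ole_total x c'.
  by move=> /olt_ole_trans /(_ xa).
have [[y Py yx]|N] := EM (exists2 y, P y & olt y x).
  by have [j yj] := olt_ole_trans yx xa; apply: (IH j y yj Py).
exists x => // c' Pc'; have [//|lt] := ole_total x c'.
by case: N; exists c'.
Qed.

Definition omax (a b : ord) : ord := OSup (fun i => if i is 0 then a else b).

Lemma ole_maxl a b : ole a (omax a b).
Proof. by apply: (@ole_OSup _ _ 0); apply: ole_refl. Qed.

Lemma ole_maxr a b : ole b (omax a b).
Proof. by apply: (@ole_OSup _ _ 1); apply: ole_refl. Qed.

Fixpoint onat (n : nat) : ord := if n is m.+1 then osucc (onat m) else OZero.

Lemma ole_onat m n : m <= n -> ole (onat m) (onat n).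
Proof.
elim: m n => [//|m IH] [//|n] /= mn.
by apply: ole_succ; apply: IH.
Qed.

(** The ordinal sum r + a, obtained by grafting [r] at the leaves of [a]. It bounds the rank when
    codes of rank [r] replace the leaves of a code of rank [a]. *)
Fixpoint oadd (r a : ord) : ord :=
  match a with
  | OZero => r
  | OSup f => OSup (fun i => oadd r (f i))
  end.

Lemma ole_addl r a : ole r (oadd r a).
Proof.
elim: a => [|f IH] /=; first exact: ole_refl.
by apply: (@ole_OSup _ _ 0); apply: IH.
Qed.

Lemma ole_add r a b : ole a b -> ole (oadd r a) (oadd r b).
Proof.
elim: a b => [|f IH] b H; first exact: ole_addl.
case: b H => [/ole_supP/(_ 0)//|g] H i /=.
by have [j Hj] := H i; exists j; apply: IH.
Qed.

(** * Codes for Borel subsets of Baire space *)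

Notation baire := (nat -> nat).

(** [Bint] intersects complements, so this one constructor yields complements, countable
    intersections and countable unions. *)
Inductive bcode : Type :=
| Bbasic of nat & nat
| Bint of (nat -> bcode).

Fixpoint bset (c : bcode) (z : baire) : Prop :=
  match c with
  | Bbasic k m => z k = m
  | Bint f => forall i, ~ bset (f i) z
  end.

Fixpoint brank (c : bcode) : ord :=
  match c with
  | Bbasic _ _ => OZero
  | Bint f => OSup (fun i => brank (f i))
  end.

Definition borel_rank (b : ord) (X : baire -> Prop) : Prop :=
  exists2 c, ole (brank c) b & forall z, bset c z <-> X z.

Definition bor (X : baire -> Prop) : Prop := exists b, borel_rank b X.

Lemma borel_rank_le a b X : ole a b -> borel_rank a X -> borel_rank b X.
Proof. by move=> ab [c ca cX]; exists c => //; apply: ole_trans ca ab. Qed.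

Lemma borel_rank_ext b X Y :
  (forall z, X z <-> Y z) -> borel_rank b X -> borel_rank b Y.
Proof. by move=> XY [c cb cX]; exists c => // z; rewrite cX. Qed.

Lemma bor_ext X Y : (forall z, X z <-> Y z) -> bor X -> bor Y.
Proof. by move=> XY [b bX]; exists b; apply: borel_rank_ext bX. Qed.

Lemma borel_rank_not b X :
  borel_rank b X -> borel_rank (osucc b) (fun z => ~ X z).
Proof.
move=> [c cb cX]; exists (Bint (fun=> c)); first by move=> i; exists 0.
by move=> z /=; split=> [/(_ 0)|H _]; rewrite cX.
Qed.

Lemma borel_rank_forall b (X : nat -> baire -> Prop) :
  (forall i, borel_rank b (X i)) ->
  borel_rank (osucc (osucc b)) (fun z => forall i, X i z).
Proof.
move=> H; have /choice[c Hc] : forall i, exists c,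
    ole (brank c) (osucc b) /\ forall z, bset c z <-> ~ X i z.
  by move=> i; have [c] := borel_rank_not (H i); exists c.
exists (Bint c) => [i|z /=]; first by exists 0; have [] := Hc i.
split=> [Hz i|Hz i]; have [_ cX] := Hc i.
  by apply: contrapT => /cX /Hz.
by move/cX; apply.
Qed.

(** The empty set is a basic set intersected with its complement, which takes rank 2; its
    complement, the whole space, takes rank 3. These constants pad families indexed by a countable
    type. *)
Lemma borel_rank_const (P : Prop) : borel_rank (onat 3) (fun=> P).
Proof.
have F : borel_rank (onat 2) (fun=> False).
  exists (Bint (fun i => if i is 0 then Bbasic 0 0
                         else Bint (fun=> Bbasic 0 0))).
    by move=> [|i]; exists 0 => // j; exists 0.
  by move=> z; split=> // H; case: (H 1) => i /=; apply: (H 0).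
have [p|np] := EM P.
  by apply: borel_rank_ext (borel_rank_not F) => z; split=> // _ [].
by apply: borel_rank_ext (borel_rank_le _ F) => //; apply: ole_onat.
Qed.

Lemma bor_seq_rank (X : nat -> baire -> Prop) :
  (forall i, bor (X i)) -> exists b, forall i, borel_rank b (X i).
Proof.
move=> /choice[b Hb]; exists (OSup b) => i.
by apply: borel_rank_le (Hb i); apply/oltW/olt_OSup.
Qed.

Lemma bor_const P : bor (fun=> P).
Proof. by exists (onat 3); apply: borel_rank_const. Qed.

Lemma bor_basic k m : bor (fun z => z k = m).
Proof. by exists OZero, (Bbasic k m). Qed.

Lemma bor_not X : bor X -> bor (fun z => ~ X z).
Proof. by move=> [b /borel_rank_not]; exists (osucc b). Qed.

Lemma bor_forall (I : countType) (X : I -> baire -> Prop) :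
  (forall i, bor (X i)) -> bor (fun z => forall i, X i z).
Proof.
move=> H; pose Y n z := if unpickle n is Some i then X i z else True.
have /bor_seq_rank[b /borel_rank_forall Hb] n : bor (Y n).
  by rewrite /Y; case: unpickle => [i|]; [apply: H|apply: bor_const].
exists (osucc (osucc b)); apply: borel_rank_ext Hb => z; split=> Hz i.
  by have := Hz (pickle i); rewrite /Y pickleK.
by rewrite /Y; case: unpickle.
Qed.

Lemma bor_exists (I : countType) (X : I -> baire -> Prop) :
  (forall i, bor (X i)) -> bor (fun z => exists i, X i z).
Proof.
move=> H; have : bor (fun z => ~ forall i, ~ X i z).
  by apply: bor_not; apply: bor_forall => i; apply: bor_not.
by apply: bor_ext => z; rewrite -existsNP; split=> -[i Hi]; exists i => //;
  apply: contrapT.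
Qed.

Lemma bor_and X Y : bor X -> bor Y -> bor (fun z => X z /\ Y z).
Proof.
move=> HX HY.
have : bor (fun z => forall b : bool, (if b then X else Y) z).
  by apply: bor_forall => -[].
apply: bor_ext => z; split=> [H|[? ?] []//].
by split; [apply: (H true)|apply: (H false)].
Qed.

Lemma bor_or X Y : bor X -> bor Y -> bor (fun z => X z \/ Y z).
Proof.
move=> HX HY.
have : bor (fun z => exists b : bool, (if b then X else Y) z).
  by apply: bor_exists => -[].
apply: bor_ext => z; split=> [[[]]|[]]; [by left|by right| |].
  by exists true.
by exists false.
Qed.

Lemma bor_imp X Y : bor X -> bor Y -> bor (fun z => X z -> Y z).
Proof.
move=> HX HY; apply: bor_ext (bor_or (bor_not HX) HY) => z.
by rewrite -implyE.
Qed.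

Fixpoint bsubst (s : nat -> nat -> bcode) (c : bcode) : bcode :=
  match c with
  | Bbasic k m => s k m
  | Bint f => Bint (fun i => bsubst s (f i))
  end.

(** Replace each leaf of a code for [X] by a code for the preimage of that basic set. The bound [r]
    is common to all leaves, so it is added once, on the left. *)
Lemma borel_rank_comp r b X (F : baire -> baire) :
  (forall k m, borel_rank r (fun z => F z k = m)) ->
  borel_rank b X -> borel_rank (oadd r b) (fun z => X (F z)).
Proof.
move=> H [c cb cX].
pose good k m c := ole (brank c) r /\ forall z, bset c z <-> F z k = m.
have /choice[s Hs] k : exists s, forall m, good k m (s m).
  have /choice[s Hs] m : exists c, good k m c by have [d] := H k m; exists d.
  by exists s.
exists (bsubst s c).
  apply: ole_trans (ole_add r cb).
  elim: (c) => [k m|f IH] /=; first by have [] := Hs k m.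
  by move=> i; exists i; apply: IH.
move=> z; rewrite -cX; elim: (c) => [k m|f IH] /=.
  by have [_ ->] := Hs k m.
by split=> Hf i /IH; apply: Hf.
Qed.

Lemma bor_coord_rank (F : baire -> baire) :
  (forall k m, bor (fun z => F z k = m)) ->
  exists r, forall k m, borel_rank r (fun z => F z k = m).
Proof.
move=> H; have [|r Hr] := @bor_seq_rank (fun n z =>
    if unpickle n is Some (k, m) then F z k = m else True).
  by move=> n; case: unpickle => [[k m]|]; [apply: H|apply: bor_const].
by exists r => k m; have := Hr (pickle (k, m)); rewrite pickleK.
Qed.

Lemma bor_comp X (F : baire -> baire) :
  (forall k m, bor (fun z => F z k = m)) -> bor X -> bor (fun z => X (F z)).
Proof.
move=> /bor_coord_rank[r Hr] [b HX].
by exists (oadd r b); apply: borel_rank_comp HX.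
Qed.

Definition bor_val (f : baire -> nat) : Prop := forall m, bor (fun z => f z = m).

Lemma bor_bind f (P : nat -> baire -> Prop) :
  bor_val f -> (forall n, bor (P n)) -> bor (fun z => P (f z) z).
Proof.
move=> Hf HP.
have : bor (fun z => exists n, f z = n /\ P n z).
  by apply: bor_exists => n; apply: bor_and.
by apply: bor_ext => z; split=> [[n [<-]]//|H]; exists (f z).
Qed.

Lemma bor_eq f g : bor_val f -> bor_val g -> bor (fun z => f z = g z).
Proof.
move=> Hf Hg; apply: (bor_bind (P := fun n z => n = g z)) => // n.
by apply: bor_ext (Hg n) => z; split.
Qed.

Lemma bor_val_coord n : bor_val (fun z => z n).
Proof. by move=> m; apply: bor_basic. Qed.

Lemma bor_val_bind f (g : nat -> baire -> nat) :
  bor_val f -> (forall n, bor_val (g n)) -> bor_val (fun z => g (f z) z).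
Proof.
move=> Hf Hg m; apply: (bor_bind (P := fun n z => g n z = m)) => // n.
exact: Hg.
Qed.

Lemma bor_val_comp (f : baire -> nat) (F : baire -> baire) :
  (forall k, bor_val (fun z => F z k)) -> bor_val f ->
  bor_val (fun z => f (F z)).
Proof. by move=> HF Hf m; apply: (@bor_comp (fun z => f z = m)) => // k; apply: HF. Qed.

(** * Sequences of points and a universal family of codes *)

Definition row (i : nat) (v : baire) : baire := fun n => v (pickle (i, n)).

Definition join (u : nat -> baire) : baire :=
  fun k => if unpickle k is Some (i, n) then u i n else 0.

Arguments row : simpl never.
Arguments join : simpl never.

Lemma row_join u i : row i (join u) = u i.
Proof. by apply/funext => n; rewrite /row /join pickleK. Qed.

Definition bcons (j : nat) (x : baire) : baire :=
  fun n => if n is m.+1 then x m else j.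

Definition btail (x : baire) : baire := fun n => x n.+1.

(** Row 0 of [x] says whether the code is basic; row [i.+1] lists the rank index
    of the [i]-th member followed by its own code. *)
Fixpoint code_of (a : ord) (x : baire) : bcode :=
  if row 0 x 0 == 0 then Bbasic (row 0 x 1) (row 0 x 2) else
  match a with
  | OZero => Bbasic 0 0
  | OSup f =>
      Bint (fun i => code_of (f (row i.+1 x 0)) (btail (row i.+1 x)))
  end.

(** The rank of a member [f i] lies below some [g j]; this [j] is written in front of the parameter
    that induction gives for [f i]. *)
Lemma code_of_surj a c : ole (brank c) a -> exists x, code_of a x = c.
Proof.
elim: c a => [k m|f IH] a ca.
  exists (join (fun=> bcons 0 (bcons k (fun=> m)))).
  by case: a {ca} => [|g] /=; rewrite !row_join.
case: a ca => [/(_ 0)//|g] ca.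
have /choice[jx Hjx] i : exists jx : nat * baire, code_of (g jx.1) jx.2 = f i.
  by have [j /IH[x Hx]] := ca i; exists (j, x).
exists (join (fun k => if k is i.+1 then bcons (jx i).1 (jx i).2 else fun=> 1)).
rewrite /=; congr Bint; apply/funext => i.
by rewrite row_join -Hjx.
Qed.

(** * Analytic sets and separation *)

Definition agree (n : nat) (z z' : baire) : Prop := forall i, i < n -> z i = z' i.

Definition open2 (U : baire -> baire -> Prop) : Prop :=
  forall z w, U z w ->
  exists n, forall z' w', agree n z z' -> agree n w w' -> U z' w'.

(** Projections of closed sets; [U] is the open complement of the closed set. *)
Definition analytic (X : baire -> Prop) : Prop :=
  exists2 U, open2 U & forall z, X z <-> exists w, ~ U z w.

Definition continuous2 (F : baire -> baire -> baire) : Prop :=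
  forall z w k, exists n, forall z' w',
    agree n z z' -> agree n w w' -> F z w k = F z' w' k.

Lemma agree_le m n z z' : m <= n -> agree n z z' -> agree m z z'.
Proof. by move=> mn H i im; apply: H; apply: leq_trans mn. Qed.

Lemma continuous2_agree F z w k : continuous2 F -> exists n, forall z' w',
  agree n z z' -> agree n w w' -> agree k (F z w) (F z' w').
Proof.
move=> HF; elim: k => [|k [n Hn]]; first by exists 0.
have [m Hm] := HF z w k; exists (maxn m n) => z' w' Hz Hw i.
rewrite ltnS leq_eqVlt => /orP[/eqP->|].
  by apply: Hm; [apply: agree_le Hz|apply: agree_le Hw]; rewrite leq_maxl.
by apply: Hn; [apply: agree_le Hz|apply: agree_le Hw]; rewrite leq_maxr.
Qed.

Lemma open2_comp U F G : open2 U -> continuous2 F -> continuous2 G ->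
  open2 (fun z w => U (F z w) (G z w)).
Proof.
move=> HU HF HG z w /HU[k Hk].
have [m Hm] := continuous2_agree z w k HF.
have [n Hn] := continuous2_agree z w k HG.
exists (maxn m n) => z' w' Hz Hw; apply: Hk.
  by apply: Hm; [apply: agree_le Hz|apply: agree_le Hw]; rewrite leq_maxl.
by apply: Hn; [apply: agree_le Hz|apply: agree_le Hw]; rewrite leq_maxr.
Qed.

Lemma continuous2_fst : continuous2 (fun z _ => z).
Proof. by move=> z w k; exists k.+1 => z' w' /(_ k (ltnSn k)). Qed.

Lemma continuous2_coord (h : nat -> nat) : continuous2 (fun _ w => w \o h).
Proof. by move=> z w k; exists (h k).+1 => z' w' _ /(_ _ (ltnSn _)). Qed.

Lemma open2_exists (U : nat -> baire -> baire -> Prop) :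
  (forall i, open2 (U i)) -> open2 (fun z w => exists i, U i z w).
Proof.
move=> HU z w [i /HU[n Hn]]; exists n => z' w' Hz Hw.
by exists i; apply: Hn.
Qed.

Lemma analytic_coord (P : nat -> Prop) k : analytic (fun z => P (z k)).
Proof.
exists (fun z _ => ~ P (z k)) => [z w H|z].
  by exists k.+1 => z' w' /(_ _ (ltnSn _)) <-.
by split=> [H|[w /contrapT//]]; exists z => /(_ H).
Qed.

(** Both halves go together because [Bint] takes complements of its members. A witness for a
    countable intersection joins one witness per member; a witness for a countable union begins with
    the index of a member. *)
Lemma bset_analytic c : analytic (bset c) /\ analytic (fun z => ~ bset c z).
Proof.
elim: c => [k m|f IH] /=.
  by split; [apply: (analytic_coord (fun j => j = m))
            |apply: (analytic_coord (fun j => j <> m))].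
split.
  have /choice[U HU] i : exists U, open2 U /\
      forall z, ~ bset (f i) z <-> exists w, ~ U z w.
    by have [_ [U]] := IH i; exists U.
  exists (fun z w => exists i, U i z (row i w)) => [|z].
    apply: open2_exists => i.
    apply: open2_comp (HU i).1 continuous2_fst _.
    exact: (continuous2_coord (fun n => pickle (i, n))).
  split=> [Hz|[w Hw] i].
    have /choice[w Hw] i : exists w, ~ U i z w by apply/(HU i).2/Hz.
    by exists (join w) => -[i]; rewrite row_join; apply: Hw.
  by apply/(HU i).2; exists (row i w) => H; apply: Hw; exists i.
have /choice[V HV] i : exists V, open2 V /\
    forall z, bset (f i) z <-> exists w, ~ V z w.
  by have [[V]] := IH i; exists V.
exists (fun z w => V (w 0) z (btail w)) => [z w H|z].
  have [n Hn] := open2_comp (HV (w 0)).1 continuous2_fst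
    (continuous2_coord S) H.
  exists n.+1 => z' w' Hz Hw; rewrite -(Hw 0) //.
  by apply: Hn; [apply: agree_le Hz|apply: agree_le Hw].
split=> [/existsNP[i /contrapT/(HV i).2[w Hw]]|[w Hw]].
  by exists (bcons i w).
by move=> /(_ (w 0)); apply; apply/(HV _).2; exists (btail w).
Qed.

Lemma bor_analytic X : bor X -> analytic X.
Proof.
move=> [b [c _ cX]]; have [[U oU HU] _] := bset_analytic c.
by exists U => // z; rewrite -cX.
Qed.

Lemma join_continuous (u : nat -> baire -> baire -> baire) :
  (forall i, continuous2 (u i)) -> continuous2 (fun z w => join (u ^~ z ^~ w)).
Proof.
move=> Hu z w k; rewrite /join; case: unpickle => [[i n]|]; last by exists 0.
exact: Hu.
Qed.

Definition bpair (z w : baire) : baire := join (fun i => if i is 0 then z else w).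

Lemma analytic_proj X :
  analytic X -> analytic (fun z => exists w, X (bpair z w)).
Proof.
move=> [U oU HU].
exists (fun z w => U (bpair z (row 0 w)) (row 1 w)) => [|z].
  have c i : continuous2 (fun _ w => row i w).
    exact: (continuous2_coord (fun n => pickle (i, n))).
  apply: (@open2_comp U (fun z w => bpair z (row 0 w)) (fun _ w => row 1 w)) => //.
  suff H : continuous2 (fun z w => join (fun i =>
      (if i is 0 then fun z _ => z else fun _ w => row 0 w) z w)).
    move=> z w k; have [n Hn] := H z w k; exists n => z' w' Hz Hw.
    have := Hn _ _ Hz Hw; rewrite /bpair.
    congr (join _ _ = join _ _).
      by apply/funext => -[].
    by apply/funext => -[].
  apply: (@join_continuous
    (fun i => if i is 0 then fun z _ => z else fun _ w => row 0 w)) => -[|i].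
    exact: continuous2_fst.
  exact: c.
split=> [[w /HU[v Hv]]|[w Hw]]; last by exists (row 0 w); apply/HU; exists (row 1 w).
by exists (bpair w v); rewrite !row_join.
Qed.

(** * Lusin separation of two disjoint projections of closed sets *)

Section Separation.
Context (U V : baire -> baire -> Prop).
Context (openU : open2 U) (openV : open2 V).
Context (disjUV : forall z u v, ~ U z u -> ~ V z v -> False).

(** A triple of a list prescribes one coordinate of the point and of each of the
    two witnesses. *)
Implicit Types (l : seq (nat * nat * nat)).

Let Part (W : baire -> baire -> Prop) (p : nat * nat * nat -> nat) l z :=
  (forall i, i < size l -> z i = (nth (0, 0, 0) l i).1.1) /\
  exists2 w, ~ W z w & forall i, i < size l -> w i = p (nth (0, 0, 0) l i).

Let A := Part U (fun t => t.1.2).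
Let B := Part V snd.

Let separable l := exists X, [/\ bor X, forall z, A l z -> X z &
                                 forall z, B l z -> ~ X z].

Let Part_rcons W p l z w (i : nat * nat * nat) : ~ W z w ->
  (forall i, i < size l -> z i = (nth (0, 0, 0) l i).1.1) ->
  (forall i, i < size l -> w i = p (nth (0, 0, 0) l i)) ->
  i.1.1 = z (size l) -> p i = w (size l) -> Part W p (rcons l i) z.
Proof.
move=> HW Hz Hw iz iw; split=> [j|].
  by rewrite size_rcons nth_rcons ltnS leq_eqVlt => /orP[/eqP->|jl];
    [rewrite ltnn eqxx|rewrite jl Hz].
exists w => // j.
by rewrite size_rcons nth_rcons ltnS leq_eqVlt => /orP[/eqP->|jl];
  [rewrite ltnn eqxx|rewrite jl Hw].
Qed.

(** Reading coordinate [size l] of the point tells apart parts that differ there. For a fixed value,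
    take the union over the next coordinate [i] of the first witness of the intersections over the
    next coordinate [j] of the second. *)
Let separable_step l :
  (forall t, separable (rcons l t)) -> separable l.
Proof.
move=> /choice[X HX].
exists (fun z => exists i, forall j, X (z (size l), i, j) z); split.
- apply: (bor_bind (P := fun n z => exists i, forall j, X (n, i, j) z)).
    exact: bor_val_coord.
  by move=> n; apply: bor_exists => i; apply: bor_forall => j; have [] := HX (n, i, j).
- move=> z [Hz [w HU Hw]]; exists (w (size l)) => j.
  by have [_ H _] := HX (z (size l), w (size l), j); apply: H; apply: Part_rcons Hw _ _.
- move=> z [Hz [w HV Hw]] [i /(_ (w (size l)))].
  by have [_ _ H] := HX (z (size l), i, w (size l)); apply: H; apply: Part_rcons Hw _ _.
Qed.

(** If the sets were inseparable, inseparability would persist along an infinite branch of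
    one-coordinate refinements, with limits [z], [u], [v]. By disjointness [U z u] or [V z v] holds;
    by openness one of the two parts is then empty at a finite stage, and a constant set separates
    it from the other. *)
Lemma separation : exists X, [/\ bor X,
  forall z w, ~ U z w -> X z & forall z w, ~ V z w -> ~ X z].
Proof.
suff [X [bX AX BX]] : separable [::].
  by exists X; split=> // z w H; [apply: AX|apply: BX]; split=> //; exists w.
apply: contrapT => nsep.
have /choice[t Ht] l : exists t, separable (rcons l t) -> separable l.
  have [H|/existsNP[t Ht]] := EM (forall t, separable (rcons l t)).
    by exists (0, 0, 0) => _; apply: separable_step.
  by exists t.
pose L n := iter n (fun l => rcons l (t l)) [::].
have nsepL n : ~ separable (L n) by elim: n => //= n IH /Ht.
have sizeL n : size (L n) = n by elim: n => //= n IH; rewrite size_rcons IH.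
have nthL n i : i < n -> nth (0, 0, 0) (L n) i = t (L i).
  elim: n => //= n IH; rewrite ltnS leq_eqVlt nth_rcons sizeL => /orP[/eqP->|lt].
    by rewrite ltnn eqxx.
  by rewrite lt IH.
pose z i := (t (L i)).1.1; pose u i := (t (L i)).1.2; pose v i := (t (L i)).2.
have Uzu : ~ U z u.
  move=> H; have [n Hn] := openU H; apply: (nsepL n); exists (fun=> False).
  split=> [|z' [Hz [w HU Hw]]|z' _ []]; first exact: bor_const.
  by apply: HU; apply: Hn => i ni; rewrite ?Hz ?Hw ?sizeL // nthL.
have Vzv : ~ V z v.
  move=> H; have [n Hn] := openV H; apply: (nsepL n); exists (fun=> True).
  split=> [|//|z' [Hz [w HV Hw]]]; first exact: bor_const.
  by case: HV; apply: Hn => i ni; rewrite ?Hz ?Hw ?sizeL // nthL.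
exact: disjUV Uzu Vzv.
Qed.

End Separation.

Lemma analytic_separation P Q : analytic P -> analytic Q ->
  (forall z, P z -> Q z -> False) ->
  exists X, [/\ bor X, forall z, P z -> X z & forall z, Q z -> ~ X z].
Proof.
move=> [U oU HU] [V oV HV] PQ.
have [z u v Hu Hv|X [bX PX QX]] := separation oU oV.
  by apply: (PQ z); [apply/HU; exists u|apply/HV; exists v].
exists X; split=> // z; first by move=> /HU[w]; apply: PX.
by move=> /HV[w]; apply: QX.
Qed.

(** * Isomorphisms and definability *)

Lemma isomorphic_refl (L : language) (M : structure L) : isomorphic M M.
Proof.
exists id; first by exists id.
by split=> [r x|g x]; congr (_ _); apply: val_inj; rewrite /= map_id.
Qed.

Lemma isomorphic_sym (L : language) (M N : structure L) :
  isomorphic M N -> isomorphic N M.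
Proof.
move=> [h [h' hK h'K] [Hr Hf]]; exists h'; first by exists h.
have HK m (x : m.-tuple N) : map_tuple h (map_tuple h' x) = x.
  by apply: val_inj; rewrite /= -map_comp (eq_map h'K) map_id.
split=> [r x|g x]; first by rewrite -Hr HK.
by apply: (can_inj hK); rewrite h'K -Hf HK.
Qed.

Lemma isomorphic_trans (L : language) (N M P : structure L) :
  isomorphic M N -> isomorphic N P -> isomorphic M P.
Proof.
move=> [h bh [Hr Hf]] [k bk [Kr Kf]]; exists (k \o h); first exact: bij_comp.
have HK m (x : m.-tuple M) : map_tuple (k \o h) x = map_tuple k (map_tuple h x).
  by apply: val_inj; rewrite /= map_comp.
by split=> [r x|g x]; rewrite HK ?Kr ?Kf ?Hr ?Hf.
Qed.

Section EnvLemmas.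
Context (L : language).
Implicit Types (M N : structure L).

Lemma env_cons0 M n (x : M) (e : 'I_n -> M) : env_cons x e ord0 = x.
Proof. by rewrite /env_cons unlift_none. Qed.

Lemma env_consS M n (x : M) (e : 'I_n -> M) i : env_cons x e (lift ord0 i) = e i.
Proof. by rewrite /env_cons liftK. Qed.

Lemma env_cons_eta M n (e : 'I_n.+1 -> M) :
  e = env_cons (e ord0) (fun i => e (lift ord0 i)).
Proof.
apply/funext => i; rewrite /env_cons; case: (unliftP ord0 i) => [j|] -> //=.
Qed.

Lemma env_cons_comp M N (h : M -> N) n (x : M) (e : 'I_n -> M) :
  h \o env_cons x e = env_cons (h x) (h \o e).
Proof. by apply/funext => i; rewrite /env_cons /=; case: unlift. Qed.

Lemma env0_eq M (e e' : 'I_0 -> M) : e = e'.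
Proof. by apply/funext => -[]. Qed.

Lemma modelsE M (phi : sentence L) (e : 'I_0 -> M) : models M phi <-> sat phi e.
Proof. by rewrite (env0_eq e (fun i => match notF (ltn_ord i) with end)). Qed.

Lemma eval_hom M N (h : M -> N)
    (Hf : forall g (x : (fun_arity g).-tuple M),
        fun_of (map_tuple h x) = h (fun_of x)) n (e : 'I_n -> M) (t : term L n) :
  Defs.eval (h \o e) t = h (Defs.eval e t).
Proof.
elim: t => [//|g ts IH] /=; rewrite -Hf; congr fun_of.
by apply: eq_from_tnth => i; rewrite tnth_mktuple (tnth_map h) tnth_mktuple IH.
Qed.

Lemma tuple_hom M N (h : M -> N)
    (Hf : forall g (x : (fun_arity g).-tuple M),
        fun_of (map_tuple h x) = h (fun_of x)) n (e : 'I_n -> M) m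
    (ts : 'I_m -> term L n) :
  [tuple Defs.eval (h \o e) (ts i) | i < m] = map_tuple h [tuple Defs.eval e (ts i) | i < m].
Proof.
apply: eq_from_tnth => i.
by rewrite tnth_mktuple (tnth_map h) tnth_mktuple eval_hom.
Qed.

Lemma sat_iso M N (h : M -> N) : bijective h ->
  (forall r (x : (rel_arity r).-tuple M), rel_of (map_tuple h x) = rel_of x) ->
  (forall g (x : (fun_arity g).-tuple M),
      fun_of (map_tuple h x) = h (fun_of x)) ->
  forall n (phi : form L n) (e : 'I_n -> M), sat phi (h \o e) <-> sat phi e.
Proof.
move=> [h' hK h'K] Hr Hf n phi.
elim: {n} phi => [||n r ts|n p IH|n p IHp q IHq|n p IHp q IHq
  |n p IH|n p IH|n p IH|n p IH]
  => //=.
- by move=> n t u e; rewrite !(eval_hom Hf); split=> [/(can_inj hK)|->].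
- by move=> e; rewrite (tuple_hom Hf) Hr.
- by move=> e; rewrite IH.
- by move=> e; rewrite IHp IHq.
- by move=> e; rewrite IHp IHq.
- by move=> e; split=> H i; apply/IH.
- by move=> e; split=> -[i Hi]; exists i; apply/IH.
- move=> e; split=> H x; first by apply/IH; rewrite env_cons_comp.
  by rewrite -(h'K x) -env_cons_comp; apply/IH.
- move=> e; split=> -[x Hx].
    by exists (h' x); apply/IH; rewrite env_cons_comp h'K.
  by exists (h x); rewrite -env_cons_comp; apply/IH.
Qed.

Lemma models_iso M N (phi : sentence L) :
  isomorphic M N -> (models M phi <-> models N phi).
Proof.
move=> [h bh [Hr Hf]];
rewrite (modelsE phi (h \o (fun i : 'I_0 => match notF (ltn_ord i) with end))).
by rewrite (sat_iso bh Hr Hf).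
Qed.

(** Each quantifier binds index 0, so the [k] bound variables come first and the free ones are
    shifted by [k]. *)
Lemma sat_FAlls M n k (p : form L (k + n)) (e : 'I_n -> M) :
  sat (FAlls p) e <->
  forall e' : 'I_(k + n) -> M, (fun i => e' (rshift k i)) = e -> sat p e'.
Proof.
elim: k p => [|k IH] p /=.
  have E (e' : 'I_(0 + n) -> M) : (fun i => e' (rshift 0 i)) = e'.
    by apply/funext => i; congr e'; apply: val_inj.
  by split=> [H e'|]; [rewrite E => ->|apply; apply: E].
rewrite IH; split=> H.
  move=> e' E; rewrite (env_cons_eta e'); apply: H.
  by rewrite -E; apply/funext => i; congr e'; apply: val_inj.
move=> e' E x; apply: H; rewrite -E; apply/funext => i.
by rewrite -[RHS](env_consS x); congr (env_cons _ _ _); apply: val_inj.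
Qed.

Lemma sat_FExs M n k (p : form L (k + n)) (e : 'I_n -> M) :
  sat (FExs p) e <->
  exists2 e' : 'I_(k + n) -> M, (fun i => e' (rshift k i)) = e & sat p e'.
Proof.
have -> : sat (FExs p) e <-> ~ sat (FAlls (FNot p)) e.
  elim: k p => [|k IH] p /=; first by split=> [?|/contrapT]; [apply|].
  rewrite IH; apply: not_iff_compat; rewrite !sat_FAlls /=.
  by split=> H e' /H; [move=> + x Hx; apply; exists x|move=> + [x]; apply].
rewrite sat_FAlls /=; split=> [|[e' E Hp] /(_ e' E)//].
by move=> /existsNP[e' /not_implyP[E /contrapT Hp]]; exists e'.
Qed.

End EnvLemmas.

(* De Morgan duality between the Sigma and Pi classes *)
Scheme is_Sigma_mut := Minimality for is_Sigma Sort Prop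
with is_Pi_mut := Minimality for is_Pi Sort Prop.

(** Negation is available up to equivalence only: above level 0 the syntactic classes contain no
    formula of the form [FNot]. *)
Definition has_neg (L : language) (C : ord -> forall n, form L n -> Prop)
    (a : ord) n (phi : form L n) : Prop :=
  exists2 psi : form L n, C a n psi &
    forall (M : structure L) (e : 'I_n -> M), sat psi e <-> ~ sat phi e.

Section Dual.
Context (L : language).

Let neg_qf C a n (phi : form L n) :
  (forall n (phi : form L n), finitary_qf phi -> C a n phi) ->
  finitary_qf phi -> has_neg C a phi.
Proof. by move=> H qf; exists (FNot phi) => //; apply: H. Qed.

Let neg_or a n (k : nat -> nat) (b : nat -> ord)
    (psi : forall i, form L (k i + n)) :
  (forall i, olt (b i) a) -> (forall i, has_neg (@is_Sigma L) (b i) (psi i)) ->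
  has_neg (@is_Pi L) a (FBigOr (fun i => FExs (psi i))).
Proof.
move=> ba H; exists (FBigAnd (fun i => FAlls (s2val (cid2 (H i))))).
  by apply: Pi_and ba _ => i; case: (cid2 (H i)).
move=> M e /=; have key i :
    sat (FAlls (s2val (cid2 (H i)))) e <-> ~ sat (FExs (psi i)) e.
  case: (cid2 (H i)) => p /= _ Hp.
  rewrite sat_FAlls sat_FExs; split=> [A [e' /A/Hp]//|A e' E].
  by apply/Hp => Hs; apply: A; exists e'.
by split=> [A [i]|A i]; [apply/key|apply/key => B; apply: A; exists i].
Qed.

Let neg_and a n (k : nat -> nat) (b : nat -> ord)
    (psi : forall i, form L (k i + n)) :
  (forall i, olt (b i) a) -> (forall i, has_neg (@is_Pi L) (b i) (psi i)) ->
  has_neg (@is_Sigma L) a (FBigAnd (fun i => FAlls (psi i))).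
Proof.
move=> ba H; exists (FBigOr (fun i => FExs (s2val (cid2 (H i))))).
  by apply: Sigma_or ba _ => i; case: (cid2 (H i)).
move=> M e /=; have key i :
    sat (FExs (s2val (cid2 (H i)))) e <-> ~ sat (FAlls (psi i)) e.
  case: (cid2 (H i)) => p /= _ Hp.
  rewrite sat_FAlls sat_FExs; split=> [[e' E /Hp A] B|]; first by apply/A/B.
  by move=> /existsNP[e' /not_implyP[E A]]; exists e' => //; apply/Hp.
by split=> [[i /key A] B|/existsNP[i /key]]; [apply/A/B|exists i].
Qed.

Lemma is_Sigma_neg a n (phi : form L n) :
  is_Sigma a phi -> has_neg (@is_Pi L) a phi.
Proof.
move: a n phi; apply: (@is_Sigma_mut L _ (has_neg (@is_Sigma L))).
- by move=> a n phi a0; apply: neg_qf => *; apply: Pi_qf.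
- by move=> a n k b psi ba _; apply: neg_or.
- by move=> a n phi a0; apply: neg_qf => *; apply: Sigma_qf.
- by move=> a n k b psi ba _; apply: neg_and.
Qed.

Lemma is_Pi_neg a n (phi : form L n) :
  is_Pi a phi -> has_neg (@is_Sigma L) a phi.
Proof.
move: a n phi; apply: (@is_Pi_mut L (has_neg (@is_Pi L))).
- by move=> a n phi a0; apply: neg_qf => *; apply: Pi_qf.
- by move=> a n k b psi ba _; apply: neg_or.
- by move=> a n phi a0; apply: neg_qf => *; apply: Sigma_qf.
- by move=> a n k b psi ba _; apply: neg_and.
Qed.

End Dual.

Lemma oeq0 a b : oeq a OZero -> oeq a b -> oeq b OZero.
Proof. by move=> [aO _] [_ ba]; split=> //; apply: ole_trans ba aO. Qed.

Lemma is_Pi_oeq (L : language) a b n (phi : form L n) :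
  oeq a b -> is_Pi a phi -> is_Pi b phi.
Proof.
move=> ab H; move: H ab; case=> {a n phi} [a n phi a0 qf|a n k c psi ca Hpsi] ab.
  by apply: Pi_qf => //; apply: oeq0 ab.
by apply: Pi_and Hpsi => i; apply: olt_ole_trans (ca i) ab.1.
Qed.

(** * Relations defined by one formula throughout a family of structures *)

Section Definability.
Context (L : language) (Z : Type) (S : Z -> structure L).
Implicit Types (a b : ord) (n : nat).

(** [S z], for [z : Z], is the family of structures in which the formula is
    evaluated. *)
Definition pi_def a n (R : forall z, ('I_n -> S z) -> Prop) : Prop :=
  exists2 phi : form L n, is_Pi a phi & forall z e, sat phi e <-> R z e.

Definition sigma_def a n (R : forall z, ('I_n -> S z) -> Prop) : Prop :=
  exists2 phi : form L n, is_Sigma a phi & forall z e, sat phi e <-> R z e.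

Lemma pi_def_ext a n (R R' : forall z, ('I_n -> S z) -> Prop) :
  (forall z e, R z e <-> R' z e) -> pi_def a R -> pi_def a R'.
Proof. by move=> RR' [p Hp pR]; exists p => // z e; rewrite pR. Qed.

Lemma sigma_def_ext a n (R R' : forall z, ('I_n -> S z) -> Prop) :
  (forall z e, R z e <-> R' z e) -> sigma_def a R -> sigma_def a R'.
Proof. by move=> RR' [p Hp pR]; exists p => // z e; rewrite pR. Qed.

Lemma pi_def_not a n (R : forall z, ('I_n -> S z) -> Prop) :
  pi_def a R -> sigma_def a (fun z e => ~ R z e).
Proof. by move=> [p /is_Pi_neg[q Hq qp] pR]; exists q => // z e; rewrite qp pR. Qed.

Lemma qf_pi_def n (phi : form L n) :
  finitary_qf phi -> pi_def OZero (fun z (e : 'I_n -> S z) => sat phi e).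
Proof. by move=> H; exists phi => //; apply: Pi_qf. Qed.

Lemma qf_sigma_def n (phi : form L n) :
  finitary_qf phi -> sigma_def OZero (fun z (e : 'I_n -> S z) => sat phi e).
Proof. by move=> H; exists phi => //; apply: Sigma_qf. Qed.

(** Numbers that encode no index contribute [FTrue] at level 0, which must lie strictly below
    [a]. *)
Lemma pi_def_forall (I : countType) a n (k : I -> nat) (b : I -> ord)
    (R : forall i z, ('I_(k i + n) -> S z) -> Prop) :
  olt OZero a -> (forall i, olt (b i) a) -> (forall i, sigma_def (b i) (R i)) ->
  pi_def a (fun z e => forall i (e' : 'I_(k i + n) -> S z),
                       (fun j => e' (rshift (k i) j)) = e -> R i z e').
Proof.
move=> a0 ba H; pose psi i := s2val (cid2 (H i)).
pose k' j := oapp k 0 (unpickle j).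
pose psi' j : form L (k' j + n) :=
  match unpickle j as o return form L (oapp k 0 o + n) with
  | Some i => psi i | None => FTrue L n end.
exists (FBigAnd (fun j => FAlls (psi' j))).
  apply: (@Pi_and _ _ _ _ (fun j => oapp b OZero (unpickle j))) => j.
    by case: unpickle.
  rewrite /psi' /k'; case: unpickle => [i|] /=; last exact: Sigma_qf.
  by rewrite /psi; case: (cid2 (H i)).
move=> z e /=; split=> [A i|A j].
  have := A (pickle i); rewrite /psi' /k' pickleK /= sat_FAlls => B e' E.
  by have := B e' E; rewrite /psi; case: (cid2 (H i)) => p /= _ ->.
rewrite /psi' /k'; case: unpickle => [i|] //=.
rewrite sat_FAlls => e' E; have := A i e' E.
by rewrite /psi; case: (cid2 (H i)) => p /= _ ->.
Qed.

Lemma pi_def_all (I : countType) a n (b : I -> ord)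
    (R : forall (i : I) z, ('I_n -> S z) -> Prop) :
  olt OZero a -> (forall i, olt (b i) a) -> (forall i, sigma_def (b i) (R i)) ->
  pi_def a (fun z e => forall i, R i z e).
Proof.
move=> a0 ba H; apply: pi_def_ext (@pi_def_forall I a n (fun=> 0) b R a0 ba H).
have E z (e' : 'I_(0 + n) -> S z) : (fun i => e' (rshift 0 i)) = e'.
  by apply/funext => i; congr e'; apply: val_inj.
move=> z e; split=> A i; first by apply: A; rewrite E.
by move=> e'; rewrite E => ->.
Qed.

Lemma olt0S b : olt OZero (osucc b).
Proof. by exists 0. Qed.

Lemma sigma_pi_def b n (R : forall z, ('I_n -> S z) -> Prop) :
  sigma_def b R -> pi_def (osucc b) R.
Proof.
move=> H; apply: pi_def_ext (@pi_def_all unit (osucc b) n (fun=> b) (fun=> R) _ _ _).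
- by move=> z e; split=> [/(_ tt)|? []].
- exact: olt0S.
- by move=> _; apply: olt_succ.
- by [].
Qed.

Lemma pi_sigma_def b n (R : forall z, ('I_n -> S z) -> Prop) :
  pi_def b R -> sigma_def (osucc b) R.
Proof.
move=> /pi_def_not/sigma_pi_def/pi_def_not; apply: sigma_def_ext => z e.
by split=> [/contrapT|r []].
Qed.

Lemma sigma_def_exists a n (k : nat) b (R : forall z, ('I_(k + n) -> S z) -> Prop) :
  olt b a -> pi_def b R ->
  sigma_def a (fun z e => exists2 e' : 'I_(k + n) -> S z,
                       (fun j => e' (rshift k j)) = e & R z e').
Proof.
move=> ba /pi_def_not H.
have a0 : olt OZero a by apply: ole_olt_trans ba.
have := @pi_def_forall unit a n (fun=> k) (fun=> b) _ a0 (fun=> ba) (fun=> H).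
move=> /pi_def_not; apply: sigma_def_ext => z e; split.
  by move=> /existsNP[_ /existsNP[e' /not_implyP[E /contrapT Re]]]; exists e'.
by move=> [e' E Re] /(_ tt e' E).
Qed.

(** One successor turns the members into Sigma formulas, as a Pi conjunction requires; the other
    puts the conjunction strictly above them. *)
Lemma pi_def_all_le (I : countType) b n (c : I -> ord)
    (R : forall (i : I) z, ('I_n -> S z) -> Prop) :
  (forall i, ole (c i) b) -> (forall i, pi_def (c i) (R i)) ->
  pi_def (osucc (osucc b)) (fun z e => forall i, R i z e).
Proof.
move=> cb H; apply: (@pi_def_all I _ n (fun i => osucc (c i))).
- exact: olt0S.
- by move=> i; apply: ole_olt_trans (ole_succ (cb i)) (olt_succ _).
- by move=> i; apply: pi_sigma_def.
Qed.

Definition definable n (R : forall z, ('I_n -> S z) -> Prop) : Prop :=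
  exists a, pi_def a R.

Lemma definable_not n (R : forall z, ('I_n -> S z) -> Prop) :
  definable R -> definable (fun z e => ~ R z e).
Proof. by move=> [a /pi_def_not/sigma_pi_def H]; exists (osucc a). Qed.

Lemma definable_ext n (R R' : forall z, ('I_n -> S z) -> Prop) :
  (forall z e, R z e <-> R' z e) -> definable R -> definable R'.
Proof. by move=> RR' [a H]; exists a; apply: pi_def_ext H. Qed.

Lemma definable_forall n (k : nat -> nat)
    (R : forall i z, ('I_(k i + n) -> S z) -> Prop) :
  (forall i, definable (R i)) ->
  definable (fun z e => forall i (e' : 'I_(k i + n) -> S z),
                       (fun j => e' (rshift (k i) j)) = e -> R i z e').
Proof.
move=> /choice[b Hb]; pose c i := osucc (b i).
exists (OSup c); apply: (@pi_def_forall nat _ _ k c).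
- by exists 0.
- exact: olt_OSup.
- by move=> i; apply: pi_sigma_def.
Qed.

Lemma definable_all n (R : forall (i : nat) z, ('I_n -> S z) -> Prop) :
  (forall i, definable (R i)) -> definable (fun z e => forall i, R i z e).
Proof.
move=> /choice[b Hb]; pose c i := osucc (b i).
exists (OSup c); apply: (@pi_def_all nat _ _ c).
- by exists 0.
- exact: olt_OSup.
- by move=> i; apply: pi_sigma_def.
Qed.

Lemma definable_and n (R R' : forall z, ('I_n -> S z) -> Prop) :
  definable R -> definable R' -> definable (fun z e => R z e /\ R' z e).
Proof.
move=> H H'; have := @definable_all n (fun i => if i is 0 then R else R').
move=> /(_ _) A; have [|a Ha] := A; first by case.
exists a; apply: pi_def_ext Ha => z e; split=> [B|[B B'] []//].
by split; [apply: (B 0)|apply: (B 1)].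
Qed.

(** Negation, countable conjunction and universal quantification preserve definability and generate
    all formulas up to equivalence; the level is left uncontrolled. *)
Lemma sat_definable n (phi : form L n) :
  definable (fun z (e : 'I_n -> S z) => sat phi e).
Proof.
have neg n' R : @definable n' (fun z e => ~ R z e) -> definable R.
  by move=> /definable_not; apply: definable_ext => z e; split=> [/contrapT|r []].
have all n' (p : form L n'.+1) : definable (fun z (e : 'I_n'.+1 -> S z) => sat p e) ->
    definable (fun z (e : 'I_n' -> S z) => sat (FAll p) e).
  move=> H; apply: definable_ext (@definable_forall n' (fun=> 1) (fun=> _) (fun=> H)).
  move=> z e; rewrite -[sat (FAll p) e]/(sat (FAlls (k := 1) p) e) sat_FAlls.
  by split=> [/(_ 0)|].
elim: {n} phi => [n|n t u|n r ts|n p IH|n p IHp q IHq|n p IHp q IHq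
  |n p IH|n p IH|n p IH|n p IH].
- by exists OZero; apply: qf_pi_def.
- by exists OZero; apply: qf_pi_def.
- by exists OZero; apply: qf_pi_def.
- exact: definable_not.
- exact: definable_and.
- apply: neg; apply: definable_ext (definable_and (definable_not IHp) (definable_not IHq)).
  by move=> z e /=; rewrite not_orE.
- exact: definable_all.
- apply: neg; apply: definable_ext (definable_all (fun i => definable_not (IH i))).
  by move=> z e /=; rewrite forallNE.
- exact: all.
- apply: neg; have := definable_not IH; have [q Hq qp] : exists2 q : form L n.+1,
    True & forall z (e : 'I_n.+1 -> S z), sat q e <-> ~ sat p e by exists (FNot p).
  move=> H; have := @all n q; move=> /(_ _)[|a Ha].
    by apply: definable_ext H => z e; rewrite qp.
  exists a; apply: pi_def_ext Ha => z e /=; rewrite -forallNE.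
  by split=> A x; [apply/qp|apply/qp]; apply: A.
Qed.

End Definability.

(** Gives S itself a Pi level, so that it can be a conjunct of the sentence to which the gap
    function of S is applied. *)
Lemma is_Pi_normal_form (L : language) (phi : sentence L) :
  exists a (psi : sentence L), is_Pi a psi /\
    forall M : structure L, models M psi <-> models M phi.
Proof.
have [a [psi Hpsi E]] := @sat_definable L (structure L) id _ phi.
by exists a, psi; split=> // M; apply: E.
Qed.

(** * Distinctness formulas *)

Section Distinct.
Context (L : language).

Definition FAndl n (l : seq (form L n)) : form L n := foldr (@FAnd L n) (FTrue L n) l.

Definition FAndf n (I : finType) (p : I -> form L n) : form L n :=
  FAndl [seq p i | i <- enum I].

Lemma FAndf_qf n (I : finType) (p : I -> form L n) :
  (forall i, finitary_qf (p i)) -> finitary_qf (FAndf p).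
Proof.
move=> H; rewrite /FAndf; elim: (enum I) => //= i l IH; split=> //.
Qed.

Lemma sat_FAndf (M : structure L) n (I : finType) (p : I -> form L n) (e : 'I_n -> M) :
  sat (FAndf p) e <-> forall i, sat (p i) e.
Proof.
have : sat (FAndf p) e <-> forall i, i \in enum I -> sat (p i) e.
  rewrite /FAndf; elim: (enum I) => //= i l ->; split=> [[Hi H] j|H].
    by rewrite inE => /orP[/eqP->//|]; apply: H.
  by split=> [|j jl]; apply: H; rewrite inE ?eqxx ?jl ?orbT.
by move=> ->; split=> H i *; [apply: H; rewrite mem_enum|apply: H].
Qed.

Definition distinct n : form L n :=
  FAndf (fun ij : 'I_n * 'I_n =>
    if ij.1 == ij.2 then FTrue L n else FNot (FEq (Var L ij.1) (Var L ij.2))).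

Lemma distinct_qf n : finitary_qf (distinct n).
Proof. by apply: FAndf_qf => ij; case: ifP. Qed.

Lemma sat_distinct (M : structure L) n (e : 'I_n -> M) :
  sat (distinct n) e <-> injective e.
Proof.
rewrite sat_FAndf; split=> [H i j ij|H [i j] /=].
  by have := H (i, j) => /=; case: eqP.
by case: eqP => // ne /= /H.
Qed.

End Distinct.

(** * Decoding points of Baire space into structures on the natural numbers *)

Section Decode.
Context (L : language).

Definition atom : countType :=
  ({r : rel_sym L & (rel_arity r).-tuple nat} +
   {g : fun_sym L & (fun_arity g).-tuple nat})%type.

Definition rel_atom r (x : (rel_arity r).-tuple nat) : atom := inl (existT _ r x).
Definition fun_atom g (x : (fun_arity g).-tuple nat) : atom := inr (existT _ g x).

(** Every point is a code, a relation holding where the coordinate is nonzero. Distinct points may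
    code the same structure; [sencode] selects one of them. *)
Definition sdecode (z : baire) : nat_structure L :=
  (fun r x => z (pickle (@rel_atom r x)) != 0,
   fun g x => z (pickle (@fun_atom g x))).

Definition dec (z : baire) : structure L := structure_of (sdecode z).

Definition pull (M : structure L) (g : nat -> M) (g' : M -> nat) : baire :=
  fun k => match unpickle k : option atom with
  | Some (inl (existT r x)) => rel_of (map_tuple g x)
  | Some (inr (existT f x)) => g' (fun_of (map_tuple g x))
  | None => 0
  end.

Lemma pull_iso M g g' : cancel g g' -> cancel g' g ->
  isomorphic (dec (@pull M g g')) M.
Proof.
move=> gK g'K; exists g; first by exists g'.
split=> [r x|f x] /=; first by rewrite /pull pickleK /=; case: (rel_of _).
by rewrite /pull pickleK g'K.
Qed.

Definition sencode (A : nat_structure L) : baire :=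
  @pull (structure_of A) id id.

Lemma sencodeK : cancel sencode sdecode.
Proof.
move=> [R F]; rewrite /sdecode /sencode /pull /=; congr pair.
  apply/functional_extensionality_dep => r; apply/funext => x; rewrite pickleK /=.
  have -> : map_tuple id x = x by apply: val_inj; rewrite /= map_id.
  by case: (R r x).
apply/functional_extensionality_dep => g; apply/funext => x; rewrite pickleK /=.
by congr (F g _); apply: val_inj; rewrite /= map_id.
Qed.

End Decode.
Arguments dec : clear implicits.
Arguments sdecode : clear implicits.

(** * Forcing a Borel set with finite injections *)

Section Forcing.
Context (L : language).

(** A condition is a duplicate-free list [s], listing the values of a bijection
    [g] at [size s - 1, ..., 0]: conditions are extended at the front. *)
Definition pos (s : seq nat) (p : nat) : nat := nth 0 (rev s) p.

Definition init (g : nat -> nat) (n : nat) : seq nat := rev (mkseq g n).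

(** Says that coordinate [k] of the code pulled back along [g] is [m], with the inverse of [g]
    eliminated: a function value is compared with [g m]. Only finitely many values of [g] then
    matter, so a condition can decide it. *)
Definition atom_val (z : baire) (g : nat -> nat) (k m : nat) : Prop :=
  match unpickle k : option (atom L) with
  | Some (inl (existT r x)) => rel_of (s := dec L z) (map_tuple g x) = m :> nat
  | Some (inr (existT f x)) => fun_of (s := dec L z) (map_tuple g x) = g m
  | None => 0 = m
  end.

(** Positive even where [k] encodes no atom, so that [atom_val_qf] always has at least one variable
    at its disposal. *)
Definition support (k m : nat) : nat :=
  match unpickle k : option (atom L) with
  | Some (inl (existT r x)) => (\max_(i < rel_arity r) tnth x i).+1
  | Some (inr (existT f x)) => (maxn m (\max_(i < fun_arity f) tnth x i)).+1
  | None => 1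
  end.

Lemma atom_val_agree z g g' k m : agree (support k m) g g' ->
  atom_val z g k m <-> atom_val z g' k m.
Proof.
rewrite /agree /support /atom_val; case: unpickle => [[[r x]|[f x]]|] // H.
  suff -> : map_tuple g x = map_tuple g' x by [].
  apply: eq_from_tnth => i; rewrite !tnth_map; apply: H; rewrite ltnS.
  exact: (leq_bigmax i).
rewrite (H m) ?ltnS ?leq_maxl //.
suff -> : map_tuple g x = map_tuple g' x by [].
apply: eq_from_tnth => i; rewrite !tnth_map; apply: H; rewrite ltnS.
by apply: leq_trans (leq_maxr _ _); apply: (leq_bigmax i).
Qed.

Lemma bset_pull z g g' k m : cancel g g' -> cancel g' g ->
  @pull L (dec L z) g g' k = m <-> atom_val z g k m.
Proof.
move=> gK g'K; rewrite /pull /atom_val.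
case: unpickle => [[[r x]|[f x]]|]; [by split| |by split].
split=> [H|->]; last exact: gK.
by rewrite -H g'K.
Qed.

(** A condition forces an intersection of complements when no extension forces a member. Lists with
    repetitions force nothing, so [t] can range over all lists. *)
Fixpoint force (z : baire) (c : bcode) (s : seq nat) : Prop :=
  match c with
  | Bbasic k m => uniq s /\ forall t, uniq (t ++ s) ->
      support k m <= size (t ++ s) -> atom_val z (pos (t ++ s)) k m
  | Bint f => uniq s /\ forall i t, ~ force z (f i) (t ++ s)
  end.

Lemma force_uniq z c s : force z c s -> uniq s.
Proof. by case: c => [k m|f] /= []. Qed.

Lemma force_mono z c s t : uniq (t ++ s) -> force z c s -> force z c (t ++ s).
Proof.
move=> u; case: c => [k m|f] /= [_ H]; split=> //.
  by move=> t'; rewrite catA; apply: H.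
by move=> i t'; rewrite catA; apply: H.
Qed.

Definition dense_index (j : nat) : option (nat * nat) := odflt None (unpickle j).

Lemma dense_indexK : cancel pickle dense_index.
Proof. by move=> o; rewrite /dense_index pickleK. Qed.

Arguments dense_index : simpl never.

(** The requirements of a code and all its subcodes in a single sequence: index [None] asks to
    decide the code itself, the others are delegated to the members. *)
Fixpoint dense_family (z : baire) (c : bcode) (j : nat) (s : seq nat) : Prop :=
  match c with
  | Bbasic _ _ => True
  | Bint f =>
      match dense_index j with
      | Some (i, j') => dense_family z (f i) j' s
      | None => force z (Bint f) s \/ exists i, force z (f i) s
      end
  end.

Lemma dense_family_dense z c j s : uniq s ->
  exists t, uniq (t ++ s) /\ dense_family z c j (t ++ s).
Proof.
move=> us; elim: c j => [k m|f IH] j; first by exists [::].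
have H : exists t, uniq (t ++ s) /\
    (force z (Bint f) (t ++ s) \/ exists i, force z (f i) (t ++ s)).
  have [[i [t Hi]]|N] := EM (exists i t, force z (f i) (t ++ s)).
    by exists t; split; [apply: force_uniq Hi|right; exists i].
  exists [::]; split=> //; left; split=> // i t Hi.
  by apply: N; exists i, t.
by rewrite /=; case: dense_index => [[i j']|].
Qed.

Definition generic z c g := forall j, exists n, dense_family z c j (init g n).

Lemma size_init g n : size (init g n) = n.
Proof. by rewrite size_rev size_mkseq. Qed.

Lemma init_uniq g n : injective g -> uniq (init g n).
Proof. by move=> gI; rewrite rev_uniq map_inj_uniq ?iota_uniq. Qed.

Lemma init_cat g m n : n <= m -> exists t, init g m = t ++ init g n.
Proof.
move=> nm; rewrite -(subnKC nm) /init /mkseq iotaD map_cat rev_cat.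
by exists (rev [seq g i | i <- iota (0 + n) (m - n)]).
Qed.

Lemma pos_init g n : agree n (pos (init g n)) g.
Proof. by move=> p pn; rewrite /pos revK nth_mkseq. Qed.

Lemma force_init_le z c g m n : injective g -> m <= n ->
  force z c (init g m) -> force z c (init g n).
Proof.
move=> gI /(init_cat g)[t E] H; rewrite E; apply: force_mono => //.
by rewrite -E init_uniq.
Qed.

Lemma generic_sub z f g i : generic z (Bint f) g -> generic z (f i) g.
Proof.
move=> G j; have [n] := G (pickle (Some (i, j))).
by rewrite [dense_family _ _ _ _]/= dense_indexK => H; exists n.
Qed.

Lemma force_truth z c g g' : cancel g g' -> cancel g' g -> generic z c g ->
  (exists n, force z c (init g n)) <-> bset c (@pull L (dec L z) g g').
Proof.
move=> gK g'K; have gI := can_inj gK.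
elim: c => [k m _|f IH G].
  rewrite [bset _ _]/= bset_pull //; split=> [[n /= [_ H]]|H].
    have [t E] := init_cat g (leq_maxl n (support k m)).
    have := H t; rewrite -E init_uniq // size_init leq_maxr => /(_ isT isT).
    apply: (@atom_val_agree z _ g _ _ _).1.
    exact: agree_le (leq_maxr _ _) (@pos_init _ _).
  exists (support k m) => /=; split=> [|t ut tk]; first exact: init_uniq.
  apply/(@atom_val_agree z _ g) => // p pk; rewrite -(pos_init g pk).
  by rewrite /pos rev_cat nth_cat size_rev size_init pk.
split=> /= [[n [_ Hn]] i /IH|H].
  move=> /(_ (@generic_sub _ _ _ _ G))[m Hm].
  have [t E] := init_cat g (leq_maxl n m).
  by apply: (Hn i t); rewrite -E; apply: force_init_le Hm => //; apply: leq_maxr.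
have [j Ej] : exists j, dense_index j = None.
  by exists (pickle (None : option (nat * nat))); apply: dense_indexK.
have [n] := G j; rewrite /= Ej => -[Hn|[i Hi]]; first by exists n.
by case: (H i); apply/IH; [apply: generic_sub|exists n].
Qed.

(** Stage [j] enters the [j]-th dense set and also puts [j] into the range, which makes the limit
    onto; it is injective because conditions have no repetitions. *)
Lemma generic_exists z c s : uniq s -> exists g g', [/\ cancel g g',
  cancel g' g, generic z c g & init g (size s) = s].
Proof.
move=> us.
have step (js : nat * seq nat) : exists t, uniq js.2 -> [/\ uniq (t ++ js.2),
    dense_family z c js.1 (t ++ js.2) & js.1 \in t ++ js.2].
  case: js => j r /=; have [ur|nur] := boolP (uniq r); last by exists [::].
  pose t0 := if j \in r then [::] else [:: j].
  have [jt0 ut0] : j \in t0 ++ r /\ uniq (t0 ++ r).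
    by rewrite /t0; case: ifP => [//|/= jr]; rewrite inE eqxx ur jr.
  have [t [ut Dt]] := dense_family_dense z c j ut0.
  by exists (t ++ t0); rewrite -catA; split=> //; rewrite mem_cat jt0 orbT.
have [ext Hext] := choice step.
pose S := fix S n := if n is m.+1 then ext (m, S m) ++ S m else s.
have uS n : uniq (S n) by elim: n => //= n /(Hext (n, S n))[].
have DS n : dense_family z c n (S n.+1) by have [] := Hext (n, S n) (uS n).
have memS n : n \in S n.+1 by have [] := Hext (n, S n) (uS n).
have catS m n : m <= n -> exists t, S n = t ++ S m.
  elim: n => [|n IH]; first by rewrite leqn0 => /eqP->; exists [::].
  rewrite leq_eqVlt => /orP[/eqP->|/IH[t /= ->]]; first by exists [::].
  by exists (ext (n, t ++ S m) ++ t); rewrite catA.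
(* All numbers below [n] occur in [S n], so the stages grow and determine [g] everywhere. *)
have sizeS n : n <= size (S n).
  rewrite -[X in X <= _](size_iota 0) uniq_leq_size ?iota_uniq // => i.
  rewrite mem_iota => /andP[_ /catS[t ->]].
  by rewrite mem_cat memS orbT.
have posS m n p : m <= n -> p < size (S m) -> pos (S n) p = pos (S m) p.
  by move=> /catS[t ->] pm; rewrite /pos rev_cat nth_cat size_rev pm.
pose g p := pos (S p.+1) p.
have gS n p : p < size (S n) -> pos (S n) p = g p.
  move=> pn; have [le|lt] := leqP n p.+1; first by rewrite /g (posS n).
  by apply: posS; [apply: ltnW|apply: sizeS].
have initS n : init g (size (S n)) = S n.
  rewrite /init -[RHS]revK; congr rev; apply: (@eq_from_nth _ 0).
    by rewrite size_mkseq size_rev.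
  by move=> i; rewrite size_mkseq => il; rewrite nth_mkseq // -(gS n).
pose g' v := index v (rev (S v.+1)).
have g'K : cancel g' g.
  move=> v; rewrite -(gS v.+1) /g' /pos ?nth_index ?mem_rev //.
  by rewrite -size_rev index_mem mem_rev.
have gI : injective g.
  move=> p q; pose n := (maxn p q).+1.
  have pn : p < size (S n) by apply: leq_trans (sizeS n); rewrite ltnS leq_maxl.
  have qn : q < size (S n) by apply: leq_trans (sizeS n); rewrite ltnS leq_maxr.
  rewrite -(gS n) // -(gS n) // /pos => /eqP.
  by rewrite nth_uniq ?size_rev ?rev_uniq // => /eqP.
exists g, g'; split=> //.
- by move=> p; apply: gI; rewrite g'K.
- by move=> j; exists (size (S j.+1)); rewrite initS.
- exact: (initS 0).
Qed.

(** A failure to force is settled by a further condition: a list refuting the atom for a basic code,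
    a condition forcing some member for [Bint f]. *)
Lemma not_force z c s : uniq s -> ~ force z c s -> exists t, uniq (t ++ s) /\
  forall g g', cancel g g' -> cancel g' g -> generic z c g ->
    init g (size (t ++ s)) = t ++ s -> ~ bset c (@pull L (dec L z) g g').
Proof.
case: c => [k m|f] us nf.
  have /existsNP[t /not_implyP[ut /not_implyP[kt nv]]] : ~ forall t,
      uniq (t ++ s) -> support k m <= size (t ++ s) ->
      atom_val z (pos (t ++ s)) k m.
    by move=> H; apply: nf.
  exists t; split=> // g g' gK g'K _ E /=; rewrite bset_pull //.
  rewrite (@atom_val_agree z g (pos (t ++ s))) // -E => p pk.
  by rewrite pos_init //; apply: leq_trans kt.
have /existsNP[i /existsNP[t /contrapT Hi]] : ~ forall i t, ~ force z (f i) (t ++ s).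
  by move=> H; apply: nf.
exists t; split=> [|g g' gK g'K G E /= /(_ i)]; first exact: force_uniq Hi.
apply; apply/(force_truth gK g'K (@generic_sub _ _ _ i G)).
by exists (size (t ++ s)); rewrite E.
Qed.

(** In both directions a generic bijection is run through a suitable condition, and invariance
    carries membership between the generic copy and [z]. *)
Lemma force_invariant z c :
  (forall g g', cancel g g' -> cancel g' g ->
     (bset c (@pull L (dec L z) g g') <-> bset c z)) ->
  force z c [::] <-> bset c z.
Proof.
move=> inv; split=> [H|H].
  have [g [g' [gK g'K G _]]] := generic_exists z c (isT : uniq [::]).
  by apply/(inv _ _ gK g'K)/force_truth => //; exists 0.
apply: contrapT => /(not_force (isT : uniq [::]))[t [ut Ht]].
have [g [g' [gK g'K G E]]] := generic_exists z c ut.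
by apply: (Ht _ _ gK g'K G E); apply/inv.
Qed.

(** * Definability of forcing *)

(** An environment read as a condition. A quantifier adds its variable at index 0, hence at the
    front of the list, which is where conditions grow. *)
Definition lst (M : Type) n (e : 'I_n -> M) : seq M := [seq e i | i <- enum 'I_n].

Lemma size_lst (M : Type) n (e : 'I_n -> M) : size (lst e) = n.
Proof. by rewrite size_map size_enum_ord. Qed.

Lemma nth_lst (M : Type) x0 n (e : 'I_n -> M) (i : 'I_n) : nth x0 (lst e) i = e i.
Proof. by rewrite (nth_map i) ?size_enum_ord // nth_ord_enum. Qed.

Lemma lst_uniq n (e : 'I_n -> nat) : uniq (lst e) <-> injective e.
Proof. by split=> [/injectiveP|/injectiveP]. Qed.

Lemma lst_extend (M : Type) (x0 : M) n k (e : 'I_n -> M) (R : seq M -> Prop) :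
  (forall e' : 'I_(k + n) -> M, (fun j => e' (rshift k j)) = e -> R (lst e')) <->
  (forall t, size t = k -> R (t ++ lst e)).
Proof.
split=> H.
  move=> t tk; pose e' (i : 'I_(k + n)) := nth x0 (t ++ lst e) i.
  have <- : lst e' = t ++ lst e.
    apply: (@eq_from_nth _ x0); rewrite size_lst ?size_cat ?size_lst ?tk // => i ik.
    by rewrite -[i]/(val (Ordinal ik)) nth_lst.
  apply: H; apply/funext => j; rewrite /e' nth_cat /= tk.
  by rewrite ltnNge leq_addr /= addKn nth_lst.
move=> e' E.
have -> : lst e' = take k (lst e') ++ lst e; last first.
  by apply: H; rewrite size_take size_lst; case: ltngtP (leq_addr n k).
rewrite -[LHS](cat_take_drop k); congr cat; apply: (@eq_from_nth _ x0).
  by rewrite size_drop !size_lst addKn.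
move=> i; rewrite size_drop size_lst addKn => il; rewrite nth_drop.
rewrite -[i in RHS]/(val (Ordinal il)) nth_lst -E.
by rewrite -[k + i]/(val (rshift k (Ordinal il))) nth_lst.
Qed.

Lemma atom_val_qf n k m : support k m <= n -> exists2 phi : form L n,
  finitary_qf phi & forall z (e : 'I_n -> dec L z),
    sat phi e <-> atom_val z (pos (lst e)) k m.
Proof.
case: n => [|n]; first by rewrite /support; case: unpickle => [[[]|[]]|].
(* [pos] counts from the back of the list, so position [p] among [n.+1] entries is variable
   [n - p]. *)
pose v p : term L n.+1 := Var L (inord (n - p)).
have ev z (e : 'I_n.+1 -> dec L z) p : p < n.+1 -> Defs.eval e (v p) = pos (lst e) p.
  move=> pn; rewrite /= /pos nth_rev size_lst // subSS -[RHS]/(nth 0 (lst e) (n - p)).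
  by rewrite -(@nth_lst _ 0) inordK // ltnS leq_subr.
have ex z (e : 'I_n.+1 -> dec L z) a (x : a.-tuple nat) :
    (forall i, tnth x i < n.+1) ->
    [tuple Defs.eval e (v (tnth x i)) | i < a] = map_tuple (pos (lst e)) x.
  by move=> H; apply: eq_from_tnth => i; rewrite tnth_mktuple tnth_map ev.
(* A truth value is 0 or 1; for larger [b] the formula is a contradiction. *)
have bool_qf b (p : form L n.+1) : finitary_qf p -> exists2 phi : form L n.+1,
    finitary_qf phi & forall z (e : 'I_n.+1 -> dec L z),
      sat phi e <-> (`[< sat p e >] = b :> nat).
  move=> qp; case: b => [|[|b]].
  - by exists (FNot p) => // z e /=; case: asboolP.
  - by exists p => // z e /=; case: asboolP.
  - by exists (FNot (FTrue L _)) => // z e /=; split=> [[]//|]; case: asbool.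
rewrite /support /atom_val; case: unpickle => [[[r x]|[f x]]|] le.
- have [phi qf Hphi] := bool_qf m (FRel (r := r) (fun i => v (tnth x i))) I.
  exists phi => // z e; rewrite Hphi /= ex ?asboolb // => i.
  by apply: leq_trans le; rewrite ltnS; apply: leq_bigmax.
- exists (FEq (App (g := f) (fun i => v (tnth x i))) (v m)) => // z e.
  rewrite [sat _ _]/= -[e _]/(Defs.eval e (v m)) ev ?ex // => [i|].
    by apply: leq_trans le; rewrite ltnS; apply: leq_trans (leq_maxr _ _); apply: leq_bigmax.
  by apply: leq_trans le; rewrite ltnS leq_maxl.
- have [phi qf Hphi] := bool_qf m (FNot (FTrue L _)) I.
  by exists phi => // z e; rewrite Hphi /=; case: asboolP => // -[].
Qed.

Lemma distinct_lst z n (e : 'I_n -> dec L z) : sat (distinct L n) e <-> uniq (lst e).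
Proof. by rewrite sat_distinct lst_uniq. Qed.

(** The leading 1 pays for the universal quantification over extensions at a basic code. The
    conjunction is indexed by lengths of extensions, and by members in the case of [Bint]; the index
    [None] states that the condition has no repetitions. *)
Lemma force_definable c n :
  pi_def (S := dec L) (oadd (onat 1) (brank c))
         (fun z (e : 'I_n -> dec L z) => force z c (lst e)).
Proof.
elim: c n => [k m|f IH] n /=.
  pose K (i : option nat) := odflt 0 i.
  pose R (i : option nat) : forall z, ('I_(K i + n) -> dec L z) -> Prop :=
    match i with
    | None => fun z e => uniq (lst e)
    | Some j => fun z e => uniq (lst e) -> support k m <= j + n ->
                  atom_val z (pos (lst e)) k m
    end.
  have HR i : sigma_def (S := dec L) OZero (R i).
    case: i => [j|]; last first.
      apply: sigma_def_ext (qf_sigma_def _ (distinct_qf L n)) => z e.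
      exact: distinct_lst.
    have [le|lt] := leqP (support k m) (j + n).
      have [p qp Hp] := atom_val_qf le.
      have := qf_sigma_def (dec L) (phi := FOr (FNot (distinct L _)) p)
        (conj (distinct_qf L _) qp).
      apply: sigma_def_ext => z e /=; rewrite Hp distinct_lst.
      split=> [[]//|H]; have [u|] := EM (uniq (lst e)); last by left.
      by right; apply: H.
    apply: sigma_def_ext (qf_sigma_def _ (I : finitary_qf (FTrue L _))) => z e.
    by split=> // _ _; rewrite leqNgt lt.
  have := pi_def_forall (olt_succ OZero) (fun=> olt_succ OZero) HR.
  apply: pi_def_ext => z e; split=> [H|[u H] [j|] e' E].
    split=> [|t ut].
      apply: (H None); by apply/funext => i; congr e; apply: val_inj.
    rewrite size_cat size_lst.
    have := (@lst_extend nat 0 n (size t) e (fun s => uniq s ->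
      support k m <= size t + n -> atom_val z (pos s) k m)).1 (H (Some (size t))).
    exact.
  - move: e' E; apply/(@lst_extend nat 0 n j e (fun s => uniq s ->
      support k m <= j + n -> atom_val z (pos s) k m)) => t <- ut.
    by have := H t ut; rewrite size_cat size_lst.
  - by have -> : e' = e by rewrite -E; apply/funext => i; congr e'; apply: val_inj.
pose K (i : option (nat * nat)) := if i is Some (_, j) then j else 0.
pose R (i : option (nat * nat)) : forall z, ('I_(K i + n) -> dec L z) -> Prop :=
  match i with
  | None => fun z e => uniq (lst e)
  | Some (i, j) => fun z e => ~ force z (f i) (lst e)
  end.
pose b (i : option (nat * nat)) :=
  if i is Some (i, _) then oadd (onat 1) (brank (f i)) else OZero.
have HR i : sigma_def (S := dec L) (b i) (R i).
  case: i => [[i j]|]; first by apply: pi_def_not; apply: IH.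
  apply: sigma_def_ext (qf_sigma_def _ (distinct_qf L n)) => z e.
  exact: distinct_lst.
have ba i : olt (b i) (OSup (fun i => oadd (onat 1) (brank (f i)))).
  by case: i => [[i j]|]; [exists i; apply: ole_refl|exists 0].
have := pi_def_forall (ba None) ba HR.
apply: pi_def_ext => z e; split=> [H|[u H] [[i j]|] e' E].
- split=> [|i t].
    apply: (H None); by apply/funext => i; congr e; apply: val_inj.
  have := (@lst_extend nat 0 n (size t) e (fun s => ~ force z (f i) s)).1
    (H (Some (i, size t))).
  exact.
- move: e' E; apply/(@lst_extend nat 0 n j e (fun s => ~ force z (f i) s)) => t _.
  exact: H.
- by have -> : e' = e by rewrite -E; apply/funext => i; congr e'; apply: val_inj.
Qed.

End Forcing.

(** * Borel complexity of forcing and of satisfaction *)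

Section BorelForcing.
Context (L : language) (Z : baire -> baire).
Context (borZ : forall k, bor_val (fun w => Z w k)).

Lemma bor_force_basic k m s : bor (fun w => force L (Z w) (Bbasic k m) s).
Proof.
apply: bor_and; first exact: bor_const.
apply: bor_forall => t; apply: bor_imp; first exact: bor_const.
apply: bor_imp; first exact: bor_const.
rewrite /atom_val; case: unpickle => [[[r x]|[f x]]|]; last exact: bor_const.
- apply: (bor_bind (P := fun n w => ((n != 0) = m :> nat))) => // n.
  exact: bor_const.
- exact: borZ.
Qed.

(** The code varies with the point, so the induction is on [a]: splitting on one coordinate of the
    parameter selects a basic code or the level [f j] of a member. *)
Lemma bor_force a s (X : baire -> baire) : (forall k, bor_val (fun w => X w k)) ->
  bor (fun w => force L (Z w) (code_of a (X w)) s).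
Proof.
elim: a s X => [|f IH] s X borX.
- apply: (bor_bind (P := fun n w => force L (Z w) (if n == 0 then
      Bbasic (row 0 (X w) 1) (row 0 (X w) 2) else Bbasic 0 0) s)) => [|n].
    exact: borX.
  case: (n == 0); last exact: bor_force_basic.
  apply: (bor_bind (P := fun k w => force L (Z w) (Bbasic k (row 0 (X w) 2)) s)).
    exact: borX.
  move=> k; apply: (bor_bind (P := fun m w => force L (Z w) (Bbasic k m) s)).
    exact: borX.
  by move=> m; apply: bor_force_basic.
- apply: (bor_bind (P := fun n w => force L (Z w) (if n == 0 then
      Bbasic (row 0 (X w) 1) (row 0 (X w) 2) else
      Bint (fun i => code_of (f (row i.+1 (X w) 0)) (btail (row i.+1 (X w))))) s))
    => [|n]; first exact: borX.
  case: (n == 0).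
    apply: (bor_bind (P := fun k w => force L (Z w) (Bbasic k (row 0 (X w) 2)) s)).
      exact: borX.
    move=> k; apply: (bor_bind (P := fun m w => force L (Z w) (Bbasic k m) s)).
      exact: borX.
    by move=> m; apply: bor_force_basic.
  apply: bor_and; first exact: bor_const.
  apply: bor_forall => i; apply: bor_forall => t; apply: bor_not.
  apply: (bor_bind (P := fun j w =>
    force L (Z w) (code_of (f j) (btail (row i.+1 (X w)))) (t ++ s))).
    exact: borX.
  by move=> j; apply: IH => k; apply: borX.
Qed.

End BorelForcing.

Lemma borel_rank_forall_count (I : countType) b (X : I -> baire -> Prop) :
  ole (onat 3) b -> (forall i, borel_rank b (X i)) ->
  borel_rank (osucc (osucc b)) (fun z => forall i, X i z).
Proof.
move=> b3 H; pose Y n z := if unpickle n is Some i then X i z else True.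
have HY n : borel_rank b (Y n).
  rewrite /Y; case: unpickle => [i|]; first exact: H.
  exact: borel_rank_le b3 (borel_rank_const True).
apply: borel_rank_ext (borel_rank_forall HY) => z; split=> Hz i.
  by have := Hz (pickle i); rewrite /Y pickleK.
by rewrite /Y; case: unpickle.
Qed.

(** The rank is uniform in the index, typically an environment with a value, so that countable
    quantification over part of the index keeps it finite. *)
Definition fin_rank (I : Type) (X : I -> baire -> Prop) : Prop :=
  exists n, forall i, borel_rank (onat n) (X i).

Lemma fin_rank_ext I (X Y : I -> baire -> Prop) :
  (forall i z, X i z <-> Y i z) -> fin_rank X -> fin_rank Y.
Proof. by move=> XY [n H]; exists n => i; apply: borel_rank_ext (H i). Qed.

Lemma fin_rank_reindex I J (h : J -> I) (X : I -> baire -> Prop) :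
  fin_rank X -> fin_rank (fun j => X (h j)).
Proof. by move=> [n H]; exists n. Qed.

Lemma fin_rank_const I (P : I -> Prop) : fin_rank (fun i _ => P i).
Proof. by exists 3 => i; apply: borel_rank_const. Qed.

Lemma fin_rank_not I (X : I -> baire -> Prop) :
  fin_rank X -> fin_rank (fun i z => ~ X i z).
Proof. by move=> [n H]; exists n.+1 => i; apply: borel_rank_not. Qed.

Lemma fin_rank_forall I (J : countType) (X : I -> J -> baire -> Prop) :
  fin_rank (fun p z => X p.1 p.2 z) -> fin_rank (fun i z => forall j, X i j z).
Proof.
move=> [n H]; exists (maxn 3 n).+2 => i; apply: borel_rank_forall_count.
  by apply: ole_onat; rewrite leq_maxl.
by move=> j; apply: borel_rank_le (H (i, j)); apply: ole_onat; rewrite leq_maxr.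
Qed.

Lemma fin_rank_exists I (J : countType) (X : I * J -> baire -> Prop) :
  fin_rank X -> fin_rank (fun i z => exists j, X (i, j) z).
Proof.
move=> [n /= H]; have : fin_rank (fun i z => forall j, ~ X (i, j) z).
  apply: fin_rank_forall; exists n.+1 => -[i j].
  exact: borel_rank_not.
move=> /fin_rank_not; apply: fin_rank_ext => i z.
by split=> [/existsNP[j /contrapT]|[j Hj] /(_ j)//]; exists j.
Qed.

Lemma fin_rank_fin I (J : finType) (X : J -> I -> baire -> Prop) :
  (forall j, fin_rank (X j)) -> fin_rank (fun p : I * J => X p.2 p.1).
Proof.
move=> /choice[n H]; exists (\max_j n j) => -[i j] /=.
by apply: borel_rank_le (H j i); apply: ole_onat; apply: leq_bigmax.
Qed.

Lemma fin_rank_and I (X Y : I -> baire -> Prop) :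
  fin_rank X -> fin_rank Y -> fin_rank (fun i z => X i z /\ Y i z).
Proof.
move=> HX HY; have H : forall b : bool, fin_rank (if b then X else Y) by case.
have := @fin_rank_forall _ bool (fun i b => (if b then X else Y) i) (fin_rank_fin H).
apply: fin_rank_ext => i z; split=> [A|[? ?] []//].
by split; [apply: (A true)|apply: (A false)].
Qed.

(** * Borel rank of satisfaction, uniform in the formula *)

Section Satisfaction.
Context (L : language).

Lemma fin_rank_tuple n m (ts : 'I_m -> term L n) :
  (forall i, fin_rank (fun (p : ('I_n -> nat) * nat) z =>
                         Defs.eval (M := dec L z) p.1 (ts i) = p.2)) ->
  fin_rank (fun (p : ('I_n -> nat) * m.-tuple nat) z =>
    [tuple Defs.eval (M := dec L z) p.1 (ts i) | i < m] = p.2).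
Proof.
move=> H; have A := @fin_rank_forall _ _ (fun (p : ('I_n -> nat) * m.-tuple nat) i z =>
    Defs.eval (M := dec L z) p.1 (ts i) = tnth p.2 i)
  (fin_rank_fin (fun i => fin_rank_reindex
     (fun p : ('I_n -> nat) * m.-tuple nat => (p.1, tnth p.2 i)) (H i))).
apply: fin_rank_ext A => -[e x] z /=; split=> [A|<- i].
  by apply: eq_from_tnth => i; rewrite tnth_mktuple.
by rewrite tnth_mktuple.
Qed.

Lemma fin_rank_eval n (t : term L n) :
  fin_rank (fun (p : ('I_n -> nat) * nat) z =>
              Defs.eval (M := dec L z) p.1 t = p.2).
Proof.
elim: t => [i|g ts IH] /=; first exact: fin_rank_const.
have H : fin_rank (fun (p : (('I_n -> nat) * nat) * (fun_arity g).-tuple nat) z =>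
    z (pickle (fun_atom p.2)) = p.1.2).
  exists 0 => -[[e y] x] /=; exists (Bbasic (pickle (fun_atom x)) y) => //.
have T := fin_rank_reindex (fun p : (('I_n -> nat) * nat) * (fun_arity g).-tuple nat =>
  (p.1.1, p.2)) (fin_rank_tuple IH).
have := fin_rank_exists (fin_rank_and T H).
apply: fin_rank_ext => -[e y] z /=; split=> [[x [<- //]]|E].
by exists [tuple Defs.eval (M := dec L z) e (ts i) | i < fun_arity g].
Qed.

Lemma fin_rank_qf n (phi : form L n) : finitary_qf phi ->
  fin_rank (fun (e : 'I_n -> nat) z => sat (M := dec L z) phi e).
Proof.
elim: {n} phi => [n|n t u|n r ts|n p IH|n p IHp q IHq|n p IHp q IHq
  |n p IH|n p IH|n p IH|n p IH] //=.
- by move=> _; apply: fin_rank_const.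
- move=> _; have := fin_rank_exists (fin_rank_and (fin_rank_eval t) (fin_rank_eval u)).
  by apply: fin_rank_ext => e z /=; split=> [[y [-> ->]]//|E];
    exists (Defs.eval (M := dec L z) e u).
- move=> _; have H : fin_rank (fun (p : ('I_n -> nat) * (rel_arity r).-tuple nat) z =>
      z (pickle (rel_atom p.2)) <> 0).
    apply: fin_rank_not; exists 0 => -[e x] /=.
    by exists (Bbasic (pickle (rel_atom x)) 0).
  have T := fin_rank_tuple (fun i => fin_rank_eval (ts i)).
  have := fin_rank_exists (fin_rank_and T H).
  apply: fin_rank_ext => e z /=; split=> [[x [-> /eqP//]]|/eqP E].
  by exists [tuple Defs.eval (M := dec L z) e (ts i) | i < rel_arity r].
- by move=> /IH; apply: fin_rank_not.
- by move=> [/IHp Hp /IHq Hq]; apply: fin_rank_and.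
- move=> [/IHp Hp /IHq Hq].
  have := fin_rank_not (fin_rank_and (fin_rank_not Hp) (fin_rank_not Hq)).
  by apply: fin_rank_ext => e z /=; rewrite -not_orE notE.
Qed.

Lemma is_Pi_inv a n (phi : form L n) : is_Pi a phi ->
  (oeq a OZero /\ finitary_qf phi) \/
  exists (k : nat -> nat) (b : nat -> ord) (psi : forall i, form L (k i + n)),
    [/\ forall i, olt (b i) a, forall i, is_Sigma (b i) (psi i) &
        phi = FBigAnd (fun i => FAlls (psi i))].
Proof.
move=> H; case: a n phi / H => [a n phi a0 qf|a n k b psi ba H]; first by left.
by right; exists k, b, psi.
Qed.

(** The finite rank obtained depends on the formula, so the common bound is taken to be omega, that
    is [OSup onat]. *)
Lemma sat_rank_qf : exists b, forall n (phi : form L n), finitary_qf phi ->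
  forall e : 'I_n -> nat, borel_rank b (fun z => sat (M := dec L z) phi e).
Proof.
exists (OSup onat) => n phi /fin_rank_qf[m H] e.
by apply: borel_rank_le (H e); apply/oltW/olt_OSup.
Qed.

(** Over the natural numbers a quantifier block ranges over countably many tuples, so a Pi formula
    is a countable intersection of instances of lower formulas. The bound depends on the level
    alone, so that all Pi classes of one level have codes of a common rank. *)
Lemma sat_rank a : exists b, forall a' n (phi : form L n), ole a' a ->
  is_Pi a' phi \/ is_Sigma a' phi ->
  forall e : 'I_n -> nat, borel_rank b (fun z => sat (M := dec L z) phi e).
Proof.
have up c : (exists b, forall a' n (phi : form L n), ole a' c -> is_Pi a' phi ->
      forall e : 'I_n -> nat, borel_rank b (fun z => sat (M := dec L z) phi e)) ->
    exists b, forall a' n (phi : form L n), ole a' c ->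
      is_Pi a' phi \/ is_Sigma a' phi ->
      forall e : 'I_n -> nat, borel_rank b (fun z => sat (M := dec L z) phi e).
  move=> [b Hb]; exists (osucc b) => a' n phi a'a [/Hb H e|/is_Sigma_neg[psi /Hb H E] e].
    by apply: borel_rank_le (H a'a e); apply/oltW/olt_succ.
  apply: borel_rank_ext (borel_rank_not (H a'a e)) => z.
  by rewrite E notE.
have [w Hw] := sat_rank_qf.
have key d b : (forall a' n (phi : form L n), olt a' d ->
      is_Sigma a' phi -> forall e : 'I_n -> nat,
        borel_rank b (fun z => sat (M := dec L z) phi e)) ->
    exists b', forall a' n (phi : form L n), ole a' d ->
      is_Pi a' phi -> forall e : 'I_n -> nat,
        borel_rank b' (fun z => sat (M := dec L z) phi e).
  move=> H; pose b1 := omax (onat 3) b; exists (omax (osucc (osucc b1)) w).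
  move=> a' n phi a'a /is_Pi_inv[[_ qf] e|[k [c [psi [ca Hpsi ->]]]] e].
    exact: borel_rank_le (ole_maxr _ _) (Hw _ _ qf e).
  apply: borel_rank_le (ole_maxl _ _) _.
  (* Environments are read off lists, so that the countable type [nat * seq nat] indexes all
     instances; lists of the wrong length impose no condition. *)
  pose R i z s := sat (M := dec L z) (psi i) (fun j => nth 0 s j).
  have A : borel_rank (osucc (osucc b1)) (fun z => forall p : nat * seq nat,
      size p.2 = k p.1 -> R p.1 z (p.2 ++ lst e)).
    apply: borel_rank_forall_count => [|[i t] /=]; first exact: ole_maxl.
    have [tk|ntk] := EM (size t = k i); last first.
      apply: borel_rank_le (ole_maxl _ _) _.
      by apply: borel_rank_ext (borel_rank_const True).
    apply: borel_rank_le (ole_maxr _ _) _.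
    have := H (c i) _ (psi i) (olt_ole_trans (ca i) a'a) (Hpsi i)
      (fun j => nth 0 (t ++ lst e) j).
    by apply: borel_rank_ext => z; split=> // /(_ tk).
  apply: borel_rank_ext A => z /=.
  have nthE m (e' : 'I_m -> nat) : (fun j : 'I_m => nth 0 (lst e') j) = e'.
    by apply/funext => j; rewrite nth_lst.
  split=> [A i|A [i t] /= tk].
    rewrite sat_FAlls => e' E; rewrite -(nthE _ e').
    move: e' E; apply/(lst_extend 0 (k i) e (R i z)) => t tk.
    exact: (A (i, t)).
  have /sat_FAlls B := A i; move: t tk; apply/(lst_extend 0 (k i) e (R i z)).
  by move=> e' E; rewrite /R nthE; apply: B.
elim: a => [|f /choice[b Hb]]; first by apply/up/(key OZero OZero).
apply/up/(key (OSup f) (OSup b)) => a' n phi [i a'i] Hphi e.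
by apply: borel_rank_le (Hb i _ _ _ a'i (or_intror Hphi) e); apply/oltW/olt_OSup.
Qed.

Lemma sat_bor n (phi : form L n) (e : 'I_n -> nat) : bor (fun z => sat (M := dec L z) phi e).
Proof.
have [a [psi Hpsi E]] := sat_definable (dec L) phi.
have [b Hb] := sat_rank a.
exists b; apply: borel_rank_ext (Hb a n psi (ole_refl a) (or_introl Hpsi) e) => z.
exact: E.
Qed.

End Satisfaction.

(** * Borel subsets of Mod(T) *)

Local Open Scope classical_set_scope.

Lemma cvg_prod_topology (I : Type) (T : I -> topologicalType)
    (F : nat -> prod_topology T) (g : prod_topology T) :
  (forall i, (fun n => F n i) @ \oo --> g i) -> F @ \oo --> g.
Proof.
move=> H; apply/cvg_sup => i U [V] [[W] oW <-] Wg WU.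
apply: (filterS WU); have : nbhs (g i) W by apply: open_nbhs_nbhs; split.
by move=> /(H i).
Qed.

Lemma cvg_eventually_eq (T : topologicalType) (F : nat -> T) (x : T) m :
  (forall n, m <= n -> F n = x) -> F @ \oo --> x.
Proof.
move=> H A nA; exists m => // n /= mn; rewrite H //; exact: nbhs_singleton.
Qed.

Section BorelMod.
Context (L : language).

Lemma sdecode_cvg (zs : nat -> baire) z : (forall n, agree n z (zs n)) ->
  (fun n => sdecode L (zs n)) @ \oo --> sdecode L z.
Proof.
move=> H; have ev k : forall n, k.+1 <= n -> zs n k = z k by move=> n /(H n k) ->.
apply: (@cvg_pair nat _ _ \oo (nbhs (sdecode L z).1) (nbhs (sdecode L z).2)
  eventually_filter (nbhs_filter _) (nbhs_filter _)
  (fun n => (sdecode L (zs n)).1) (fun n => (sdecode L (zs n)).2)).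
- apply: cvg_prod_topology => r; apply: cvg_prod_topology => x.
  apply: (@cvg_eventually_eq _ _ _ (pickle (rel_atom x)).+1) => n /ev.
  by rewrite /sdecode /= => ->.
- apply: cvg_prod_topology => r; apply: cvg_prod_topology => x.
  apply: (@cvg_eventually_eq _ _ _ (pickle (fun_atom x)).+1) => n /ev.
  by rewrite /sdecode /= => ->.
Qed.

(** The preimage is the union of the cylinders inside it: otherwise points decoding outside [O]
    would converge to a point decoding into [O]. *)
Lemma bor_open_decode (O : set (nat_structure L)) : open O ->
  bor (fun z => O (sdecode L z)).
Proof.
move=> oO; pose C (l : seq nat) := forall z, agree (size l) (nth 0 l) z -> O (sdecode L z).
have : bor (fun z => exists l : seq nat, C l /\ forall i : 'I_(size l), z i = nth 0 l i).
  apply: bor_exists => l; apply: bor_and; first exact: bor_const.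
  by apply: bor_forall => i; apply: bor_basic.
apply: bor_ext => z; split=> [[l [Cl Hl]]|Oz].
  by apply: Cl => i il; rewrite (Hl (Ordinal il)).
apply: contrapT => N.
have /choice[zs Hzs] n : exists z', agree n z z' /\ ~ O (sdecode L z').
  apply: contrapT => N'; apply: N; exists (mkseq z n).
  split=> [z'|i]; last by rewrite nth_mkseq // -{2}(size_mkseq z n).
  rewrite /C size_mkseq => A; apply: contrapT => nO; apply: N'; exists z'; split=> //.
  by move=> i ni; rewrite -A // nth_mkseq.
have /(_ O) := @sdecode_cvg zs z (fun n => (Hzs n).1).
move=> /(_ (open_nbhs_nbhs (conj oO Oz)))[n _ /(_ n (leqnn n))].
by have [] := Hzs n.
Qed.

(** The sets that admit such a [Y] form a sigma-algebra containing the open sets. [Y] is prescribed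
    only on codes of models of [T]. *)
Lemma borel_bor (T : sentence L) (X : set (Mod T)) : borel X ->
  exists Y, bor Y /\ forall (A : Mod T) z, sdecode L z = set_val A -> (X A <-> Y z).
Proof.
pose G := [set X : set (Mod T) | exists Y, bor Y /\
  forall (A : Mod T) z, sdecode L z = set_val A -> (X A <-> Y z)].
suff : borel (X := Mod T) `<=` G by apply.
apply: smallest_sub => [|U [W oW <-]]; last first.
  exists (fun z => W (sdecode L z)); split; first exact: bor_open_decode.
  by move=> A z ->.
split.
- by exists (fun=> False); split=> //; apply: bor_const.
- move=> A [Y [bY HY]]; exists (fun z => ~ Y z); split; first exact: bor_not.
  by move=> B z /HY E; rewrite -E; split=> [[]|].
- move=> F /choice[Y HY]; exists (fun z => exists i, Y i z); split.
    by apply: bor_exists => i; have [] := HY i.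
  move=> A z E; split=> [[i _ FA]|[i Yi]]; exists i => //.
    by apply/((HY i).2 A z E).
  by apply/((HY i).2 A z E).
Qed.

Lemma open_rel r (x : (rel_arity r).-tuple nat) b :
  open [set A : nat_structure L | A.1 r x = b].
Proof.
have c : continuous (fun A : nat_structure L => A.1 r x).
  move=> A; apply: (@continuous_comp _ _ _ (fun A : nat_structure L => A.1 r) (proj x)).
    apply: (@continuous_comp _ _ _ (fst : nat_structure L -> _) (proj r)).
      exact: cvg_fst.
    exact: proj_continuous.
  exact: proj_continuous.
apply: (@open_comp _ _ (fun A : nat_structure L => A.1 r x) [set b]).
  by move=> A _; apply: c.
exact: discrete_open.
Qed.

Lemma open_fun g (x : (fun_arity g).-tuple nat) m :
  open [set A : nat_structure L | A.2 g x = m].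
Proof.
have c : continuous (fun A : nat_structure L => A.2 g x).
  move=> A; apply: (@continuous_comp _ _ _ (fun A : nat_structure L => A.2 g) (proj x)).
    apply: (@continuous_comp _ _ _ (snd : nat_structure L -> _) (proj g)).
      exact: cvg_snd.
    exact: proj_continuous.
  exact: proj_continuous.
apply: (@open_comp _ _ (fun A : nat_structure L => A.2 g x) [set m]).
  by move=> A _; apply: c.
exact: discrete_open.
Qed.

Lemma open_encode (k m : nat) : open [set A : nat_structure L | sencode A k = m].
Proof.
rewrite /sencode /pull; case: unpickle => [[[r x]|[g x]]|].
- case: m => [|[|m]].
  + have := @open_rel r (map_tuple id x) false; congr open.
    by apply/seteqP; split=> A /=; case: (A.1 _ _).
  + have := @open_rel r (map_tuple id x) true; congr open.
    by apply/seteqP; split=> A /=; case: (A.1 _ _).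
  + have := @open0 (nat_structure L); congr open.
    by apply/seteqP; split=> A //=; case: (A.1 _ _).
- exact: (@open_fun g (map_tuple id x) m).
- case: m => [|m].
    have := @openT (nat_structure L); congr open.
    by apply/seteqP; split.
  have := @open0 (nat_structure L); congr open.
  by apply/seteqP; split.
Qed.

Lemma borel_encode (T : sentence L) k m :
  borel [set A : Mod T | sencode (set_val A) k = m].
Proof.
apply: sub_gen_smallest.
by exists [set A : nat_structure L | sencode A k = m] => //; apply: open_encode.
Qed.

End BorelMod.

Lemma borelT (X : topologicalType) : borel [set: X].
Proof. by apply: sub_gen_smallest; apply: openT. Qed.

(** * Countable structures *)

Section Skolem.
Context (L : language) (M : structure L) (m0 : M).

Definition is_embedding (N : structure L) (h : N -> M) : Prop :=
  [/\ injective h,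
      forall r (x : (rel_arity r).-tuple N), rel_of (map_tuple h x) = rel_of x &
      forall g (x : (fun_arity g).-tuple N), fun_of (map_tuple h x) = h (fun_of x)].

(** [F] lists Skolem functions: an embedded structure whose range is closed under them agrees on
    [phi]. They act on lists, so that all arities share one type. *)
Definition skolem n (phi : form L n) (F : nat -> seq M -> M) : Prop :=
  forall (N : structure L) (h : N -> M), is_embedding h ->
  (forall i s, exists y, h y = F i (map h s)) ->
  forall e : 'I_n -> N, sat phi e <-> sat phi (h \o e).

Let merge (F : nat -> nat -> seq M -> M) : nat -> seq M -> M :=
  fun k => if unpickle k is Some (i, j) then F i j else fun=> m0.

Let mergeP (F : nat -> nat -> seq M -> M) (N : structure L) (h : N -> M) :
  (forall k s, exists y, h y = merge F k (map h s)) ->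
  forall i j s, exists y, h y = F i j (map h s).
Proof. by move=> H i j s; have := H (pickle (i, j)) s; rewrite /merge pickleK. Qed.

Let skolem_ex n (p : form L n.+1) F : skolem p F -> exists F', skolem (FEx p) F'.
Proof.
move=> HF.
have /choice[w Hw] (s : seq M) : exists x, forall y,
    sat p (env_cons y (fun i => nth m0 s i)) ->
    sat p (env_cons x (fun i => nth m0 s i)).
  have [[x Hx]|N] := EM (exists x, sat p (env_cons x (fun i => nth m0 s i))).
    by exists x.
  by exists m0 => y Hy; case: N; exists y.
exists (merge (fun i j => if i is 0 then w else F j)) => N h emb /mergeP H e /=.
have HFp := HF N h emb (H 1).
split=> [[x /HFp]|[x Hx]]; first by rewrite env_cons_comp; exists (h x).
have [y Hy] := H 0 0 (lst e).
exists y; apply/HFp; rewrite env_cons_comp Hy.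
have E : (fun i : 'I_n => nth m0 (map h (lst e)) i) = h \o e.
  by apply/funext => i; rewrite -map_comp -/(lst (h \o e)) nth_lst.
by have := Hw (map h (lst e)) x; rewrite E; apply.
Qed.

Lemma skolem_exists n (phi : form L n) : exists F, skolem phi F.
Proof.
elim: {n} phi => [n|n t u|n r ts|n p [F HF]|n p [F HF] q [G HG]
  |n p [F HF] q [G HG]|n p /choice[F HF]|n p /choice[F HF]|n p [F HF]|n p [F HF]].
- by exists (fun=> fun=> m0).
- exists (fun=> fun=> m0) => N h [hI _ Hf] _ e /=.
  by rewrite !(eval_hom Hf); split=> [->|/hI].
- exists (fun=> fun=> m0) => N h [hI Hr Hf] _ e /=.
  by rewrite (tuple_hom Hf) Hr.
- by exists F => N h emb H e /=; rewrite (HF _ _ emb H).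
- exists (merge (fun i => if i is 0 then F else G)) => N h emb /mergeP H e /=.
  by rewrite (HF _ _ emb (H 0)) (HG _ _ emb (H 1)).
- exists (merge (fun i => if i is 0 then F else G)) => N h emb /mergeP H e /=.
  by rewrite (HF _ _ emb (H 0)) (HG _ _ emb (H 1)).
- exists (merge F) => N h emb /mergeP H e /=.
  by split=> A i; apply/(HF i _ _ emb (H i)).
- exists (merge F) => N h emb /mergeP H e /=.
  by split=> -[i A]; exists i; apply/(HF i _ _ emb (H i)).
- have [|F' HF'] := @skolem_ex n (FNot p) F.
    by move=> N h emb H e /=; rewrite (HF _ _ emb H).
  exists F' => N h emb H e; have /= := HF' N h emb H e.
  by rewrite !existsNE => E; split=> A; apply: contrapT => /E.
- exact: skolem_ex HF.
Qed.

(** The values of finite trees labelled by function symbols and Skolem functions form a countable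
    closed set. It is needed because satisfiability allows structures of any cardinality. *)
Lemma countable_elementary (phi : sentence L) :
  exists2 N : structure L, countable_structure N & (models N phi <-> models M phi).
Proof.
have [F HF] := skolem_exists phi.
pose G k (s : seq M) : M :=
  match unpickle k : option (fun_sym L + nat) with
  | Some (inl g) => if insub s is Some x then fun_of (x : (fun_arity g).-tuple M) else m0
  | Some (inr j) => F j s
  | None => m0
  end.
pose val_tree := fix val_tree (t : GenTree.tree unit) : M :=
  match t with
  | GenTree.Leaf _ => m0
  | GenTree.Node k ts => G k (map val_tree ts)
  end.
pose D := {x : M | exists t, val_tree t = x}.
pose h : D -> M := sval.
have hI : injective h by move=> x y; apply: eq_sig_hprop => z p q; apply: Prop_irrelevance.
have /choice[tr Htr] (x : D) : exists t, val_tree t = h x by case: x.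
have closed k s : exists y, h y = G k (map h s).
  have Hs : exists t, val_tree t = G k (map h s).
    exists (GenTree.Node k (map tr s)) => /=; congr (G k _).
    by rewrite -map_comp; apply: eq_map.
  by exists (exist (fun x => exists t, val_tree t = x) _ Hs).
have Hf g (x : (fun_arity g).-tuple D) : exists y, fun_of (map_tuple h x) = h y.
  have [y Hy] := closed (pickle (inl g : fun_sym L + nat)%type) x.
  exists y; rewrite Hy /G pickleK -[map h x]/(val (map_tuple h x)) valK //.
have d0 : inhabited D by exists; exists m0, (GenTree.Leaf tt).
pose N := @MkStructure L D d0 (fun r x => rel_of (map_tuple h x))
  (fun g x => sval (cid (Hf g x))).
have emb : @is_embedding N h.
  by split=> // g x; rewrite /=; case: cid.
exists N.
  apply/countable_injP; exists (fun x => pickle (tr x)) => x y _ _.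
  move=> /(pcan_inj pickleK) E; apply: hI.
  by rewrite -(Htr x) -(Htr y) E.
rewrite /models (HF N h emb).
  by rewrite (env0_eq (h \o _) (fun i => match notF (ltn_ord i) with end)).
move=> i s; have [y Hy] := closed (pickle (inr i : fun_sym L + nat)%type) s.
by exists y; rewrite Hy /G pickleK.
Qed.

End Skolem.

Lemma satisfiable_countable (L : language) (phi : sentence L) : satisfiable phi ->
  exists2 M : structure L, countable_structure M & models M phi.
Proof.
move=> [M Mphi]; have [m0] := dom_inhabited M.
by have [N cN E] := countable_elementary m0 phi; exists N => //; apply/E.
Qed.

(** * Countable structures with finite and with infinite domain *)

Section FiniteInfinite.
Context (L : language).

Lemma infinite_iso_dec (M : structure L) : countable_structure M ->
  infinite_set [set: M] -> exists z, isomorphic (dec L z) M.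
Proof.
move=> cM iM; have /card_set_bijP[f [_ fI fS]] := eq_card_nat cM iM.
have /choice[g gK] n : exists x, f x = n by have [x _] := fS n I; exists x.
have Kg : cancel f g by move=> x; apply: fI; rewrite ?inE.
by exists (@pull L M g f); apply: pull_iso.
Qed.

Lemma finite_enum (M : structure L) : finite_set [set: M] ->
  exists n (c : 'I_n -> M), bijective c.
Proof.
move=> /finite_setP[n /card_set_bijP[f [fn fI fS]]]; exists n.
have /choice[c Hc] (i : 'I_n) : exists x, f x = i.
  by have [x _] := fS i (ltn_ord i); exists x.
have fnP x : f x < n by apply: fn.
exists c, (fun x => Ordinal (fnP x)) => [i|x]; first by apply: val_inj; apply: Hc.
by apply: fI; rewrite ?inE // Hc.
Qed.

Definition infinite_axiom_holds (M : structure L) : Prop :=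
  forall n, exists e : 'I_(n + 0) -> M, injective e.

(** Sentences obtained by forcing are controlled on decoded structures only; adding this axiom makes
    every countable model isomorphic to a decoded one. *)
Lemma infinite_axiom : exists2 phi : sentence L, is_Pi (onat 2) phi &
  forall M : structure L, models M phi <-> infinite_axiom_holds M.
Proof.
have H n : sigma_def (S := id : structure L -> structure L) (n := 0) (onat 1)
    (fun M e => exists2 e' : 'I_(n + 0) -> M, (fun j => e' (rshift n j)) = e & injective e').
  apply: (sigma_def_exists (k := n) (olt_succ OZero)).
  apply: pi_def_ext (qf_pi_def id (distinct_qf L (n + 0))) => M e.
  exact: sat_distinct.
have [phi Pphi Hphi] := pi_def_all (olt0S (onat 1)) (fun=> olt_succ (onat 1)) H.
exists phi => // M; rewrite /models Hphi.
split=> A n; have [e] := A n; first by exists e.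
by exists e => //; apply: env0_eq.
Qed.

Lemma infinite_axiom_infinite (M : structure L) :
  infinite_axiom_holds M -> infinite_set [set: M].
Proof.
move=> H /finite_enum[n [c [c' cK c'K]]]; have [e eI] := H n.+1.
have := leq_card (c' \o e) (inj_comp (can_inj c'K) eI).
by rewrite !card_ord addn0 ltnn.
Qed.

Lemma infinite_axiom_dec z : infinite_axiom_holds (dec L z).
Proof. by move=> n; exists (fun i => i : nat) => i j /val_inj. Qed.

(** Some tuple without repetitions realises the atomic diagram and exhausts the domain: an
    existential block over a Pi_1 formula, so Sigma_2 and hence Pi_3. *)
Lemma finite_scott_sentence (M : structure L) : finite_set [set: M] ->
  has_Pi_scott_sentence M (onat 3).
Proof.
move=> /finite_enum[n]; rewrite -(addn0 n) => -[c bc].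
have [c' cK c'K] := bc; set m := n + 0 in c bc c' cK c'K *.
pose I : countType := option (option
  ({r : rel_sym L & (rel_arity r).-tuple 'I_m} +
   {g : fun_sym L & (fun_arity g).-tuple 'I_m})%type).
pose K (i : I) := if i is Some None then 1 else 0.
pose R (i : I) : forall N : structure L, ('I_(K i + m) -> N) -> Prop :=
  match i with
  | None => fun N e => injective e
  | Some None => fun N e => exists i, e (rshift 1 i) = e ord0
  | Some (Some (inl (existT r x))) => fun N e =>
      rel_of (map_tuple e x) = rel_of (map_tuple c x)
  | Some (Some (inr (existT f x))) => fun N e =>
      fun_of (map_tuple e x) = e (c' (fun_of (map_tuple c x)))
  end.
have tupE (N : structure L) a (x : a.-tuple 'I_m) (e : 'I_m -> N) :
    [tuple Defs.eval e (Var L (tnth x i)) | i < a] = map_tuple e x.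
  by apply: eq_from_tnth => i; rewrite tnth_mktuple tnth_map.
have HR i : sigma_def (S := id : structure L -> structure L) OZero (R i).
  case: i => [[[[r x]|[f x]]|]|].
  - pose p := FRel (r := r) (fun i => Var L (tnth x i)).
    pose q := if rel_of (map_tuple c x) then p else FNot p.
    have qf : finitary_qf q by rewrite /q; case: ifP.
    apply: sigma_def_ext (qf_sigma_def id qf) => N e.
    rewrite /q /p; case E: (rel_of (map_tuple c x)) => /=; rewrite tupE E //.
    by apply: (iff_trans (rwP negP)); split=> [/negbTE|->].
  - pose p := FEq (App (g := f) (fun i => Var L (tnth x i)))
                  (Var L (c' (fun_of (map_tuple c x)))).
    apply: sigma_def_ext (@qf_sigma_def _ _ id _ p Logic.I) => N e.
    by rewrite /p /= tupE.
  - pose p := FNot (FAndf (fun i : 'I_m =>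
      FNot (FEq (Var L (rshift 1 i)) (Var L (ord0 : 'I_(1 + m)))))).
    have qf : finitary_qf p by apply: FAndf_qf.
    apply: sigma_def_ext (qf_sigma_def id qf) => N e.
    rewrite /p /= sat_FAndf /=; split=> [/existsNP[i /contrapT]|[i E]]; first by exists i.
    by move=> /(_ i).
  - apply: sigma_def_ext (qf_sigma_def id (distinct_qf L m)) => N e.
    exact: sat_distinct.
have H := pi_def_forall (olt_succ OZero) (fun=> olt_succ OZero) HR.
have [phi Pphi Hphi] := sigma_pi_def (@sigma_def_exists _ _ _ (onat 2) 0 n _ _ (olt_succ _) H).
exists phi => // N _; rewrite /models Hphi.
have id0 (e : 'I_m -> N) : (fun j => e (rshift 0 j : 'I_m)) = e.
  by apply/funext => i; congr e; apply: val_inj.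
split=> [[e _ He]|[h bh [Hr Hf]]].
  have eI := He None e (id0 e).
  have eS y : exists i, e i = y.
    have E : (fun j => env_cons y e (rshift 1 j)) = e.
      apply/funext => j; rewrite -[RHS](env_consS y).
      by congr (env_cons _ _ _); apply: val_inj.
    have [i] := He (Some None) (env_cons y e) E.
    rewrite env_cons0 => Hi; exists i; rewrite -Hi.
    exact: (esym (congr1 (fun e' => e' i) E)).
  have /choice[e' e'K] := eS.
  have eC (a : nat) (x : a.-tuple M) : map_tuple (e \o c') x = map_tuple e (map_tuple c' x).
    by apply: val_inj; rewrite /= map_comp.
  have cC (a : nat) (x : a.-tuple M) : map_tuple c (map_tuple c' x) = x.
    by apply: val_inj; rewrite /= -map_comp (eq_map c'K) map_id.
  exists (e \o c').
    apply: bij_comp; last by exists c.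
    by exists e' => // i; apply: eI; rewrite e'K.
  split=> [r x|f x].
    have := He (Some (Some (inl (existT _ r (map_tuple c' x))))) e (id0 e).
    by rewrite /= cC eC.
  have := He (Some (Some (inr (existT _ f (map_tuple c' x))))) e (id0 e).
  by rewrite /= cC eC.
have cC (a : nat) (x : a.-tuple 'I_m) : map_tuple (h \o c) x = map_tuple h (map_tuple c x).
  by apply: val_inj; rewrite /= map_comp.
exists (h \o c) => [|i e]; first exact: env0_eq.
case: i e => [[[[r x]|[f x]]|]|] e E.
- by rewrite -[e]id0 E /= cC Hr.
- by rewrite -[e]id0 E /= cC Hf c'K.
- have [h' hK h'K] := bh; exists (c' (h' (e ord0))).
  by rewrite -[LHS]/((fun j => e (rshift 1 j)) _) E /= c'K h'K.
- by rewrite -[e]id0 E; apply: inj_comp (bij_inj bh) (bij_inj bc).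
Qed.

End FiniteInfinite.

(** * Invariant Borel sets *)

Section LopezEscobar.
Context (L : language).

(** Forcing by the empty condition is expressed by a sentence, whether or not the code defines an
    invariant set. *)
Lemma force_iso z z' c : isomorphic (dec L z) (dec L z') ->
  force L z c [::] -> force L z' c [::].
Proof.
move=> zz'; have [phi _ H] := force_definable L c 0.
have lst0 y (e : 'I_0 -> dec L y) : lst e = [::].
  by apply: size0nil; rewrite size_lst.
pose e0 y (i : 'I_0) : dec L y := match notF (ltn_ord i) with end.
have E y : models (dec L y) phi <-> force L y c [::].
  by rewrite (modelsE phi (e0 y)) H lst0.
by rewrite -!E; apply: (models_iso phi zz').1.
Qed.

(** The Lopez-Escobar theorem in Vaught's level-by-level form. *)
Lemma lopez_escobar b (X : baire -> Prop) : borel_rank b X ->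
  (forall z z', isomorphic (dec L z) (dec L z') -> X z -> X z') ->
  exists d (phi : sentence L), [/\ ole d (oadd (onat 1) b), is_Pi d phi &
    forall z, models (dec L z) phi <-> X z].
Proof.
move=> [c cb cX] inv; have [phi Pphi H] := force_definable L c 0.
exists (oadd (onat 1) (brank c)), phi; split=> //; first exact: ole_add.
move=> z; rewrite (modelsE phi (fun i : 'I_0 => match notF (ltn_ord i) with end)) H.
have -> : forall e : 'I_0 -> dec L z, lst e = [::].
  by move=> e; apply: size0nil; rewrite size_lst.
rewrite force_invariant // => g g' gK g'K; rewrite !cX.
have I := pull_iso (M := dec L z) gK g'K.
by split; apply: inv => //; apply: isomorphic_sym.
Qed.

Lemma bor_models (phi : sentence L) : bor (fun z => models (dec L z) phi).
Proof.
pose e0 (i : 'I_0) : nat := match notF (ltn_ord i) with end.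
by apply: bor_ext (sat_bor phi e0) => z; rewrite -modelsE.
Qed.

(** With the isomorphism and its inverse as data the condition is Borel; isomorphism is its
    projection, hence analytic. *)
Definition iso_graph (h h' y z : baire) : Prop :=
  [/\ forall n, h' (h n) = n, forall n, h (h' n) = n,
      forall (p : {r : rel_sym L & (rel_arity r).-tuple nat}),
        (z (pickle (rel_atom (map_tuple h (tagged p)))) != 0) =
        (y (pickle (rel_atom (tagged p))) != 0) &
      forall (p : {g : fun_sym L & (fun_arity g).-tuple nat}),
        z (pickle (fun_atom (map_tuple h (tagged p)))) =
        h (y (pickle (fun_atom (tagged p))))].

Lemma iso_graphP y z :
  isomorphic (dec L y) (dec L z) <-> exists h h', iso_graph h h' y z.
Proof.
split=> [[h [h' hK h'K] [Hr Hf]]|[h [h' [hK h'K Hr Hf]]]].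
  by exists h, h'; split=> // -[r x]; [apply: Hr|apply: Hf].
exists h; first by exists h'.
split=> [r x|g x]; first exact: (Hr (existT _ r x)).
exact: (Hf (existT _ g x)).
Qed.

Lemma bor_map_tuple (H : baire -> baire) n (x : n.-tuple nat)
    (P : n.-tuple nat -> baire -> Prop) :
  (forall k, bor_val (fun w => H w k)) -> (forall y, bor (P y)) ->
  bor (fun w => P (map_tuple (H w) x) w).
Proof.
move=> bH bP.
have : bor (fun w => exists y : n.-tuple nat,
    (forall i, H w (tnth x i) = tnth y i) /\ P y w).
  apply: bor_exists => y; apply: bor_and (bP y).
  by apply: bor_forall => i; apply: bH.
apply: bor_ext => w; split=> [[y [E]]|A].
  suff -> : map_tuple (H w) x = y by [].
  by apply: eq_from_tnth => i; rewrite tnth_map.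
by exists (map_tuple (H w) x); split=> // i; rewrite tnth_map.
Qed.

Lemma bor_iso_graph (H H' Y Z : baire -> baire) :
  (forall k, bor_val (fun w => H w k)) -> (forall k, bor_val (fun w => H' w k)) ->
  (forall k, bor_val (fun w => Y w k)) -> (forall k, bor_val (fun w => Z w k)) ->
  bor (fun w => iso_graph (H w) (H' w) (Y w) (Z w)).
Proof.
move=> bH bH' bY bZ.
have inv (F G : baire -> baire) : (forall k, bor_val (fun w => F w k)) ->
    (forall k, bor_val (fun w => G w k)) -> bor (fun w => forall n, G w (F w n) = n).
  move=> bF bG; apply: bor_forall => n.
  by apply: (bor_bind (P := fun m w => G w m = n)) => // m; apply: bG.
have : bor (fun w => (forall n, H' w (H w n) = n) /\ (forall n, H w (H' w n) = n) /\
    (forall (p : {r : rel_sym L & (rel_arity r).-tuple nat}),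
        (Z w (pickle (rel_atom (map_tuple (H w) (tagged p)))) != 0) =
        (Y w (pickle (rel_atom (tagged p))) != 0)) /\
      forall (p : {g : fun_sym L & (fun_arity g).-tuple nat}),
        Z w (pickle (fun_atom (map_tuple (H w) (tagged p)))) =
        H w (Y w (pickle (fun_atom (tagged p))))).
  apply: bor_and; first exact: inv.
  apply: bor_and; first exact: inv.
  apply: bor_and.
    apply: bor_forall => p.
    apply: (@bor_map_tuple H _ (tagged p) (fun x w => (Z w (pickle (rel_atom x)) != 0) =
        (Y w (pickle (rel_atom (tagged p))) != 0))) => // x.
    apply: (bor_bind (P := fun m w => (m != 0) =
        (Y w (pickle (rel_atom (tagged p))) != 0))) => // m.
    by apply: (bor_bind (P := fun m' w => (m != 0) = (m' != 0))) => // m'; apply: bor_const.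
  apply: bor_forall => p.
  apply: (@bor_map_tuple H _ (tagged p) (fun x w => Z w (pickle (fun_atom x)) =
      H w (Y w (pickle (fun_atom (tagged p)))))) => // x.
  apply: bor_eq => //.
  exact: (@bor_val_bind (fun w => Y w _) (fun m w => H w m)).
by apply: bor_ext => w; split=> [[? [? []]]|[]].
Qed.

End LopezEscobar.

Section ModPoints.
Context (L : language) (T : sentence L).

Lemma Mod_models (A : Mod T) : models (Mod_structure A) T.
Proof. by case: A => A HA; apply: (set_mem HA). Qed.

Lemma Mod_exists z : models (dec L z) T -> exists A : Mod T, set_val A = sdecode L z.
Proof. by move=> H; exists (exist _ (sdecode L z) (mem_set H)). Qed.

Lemma Mod_dec (A : Mod T) z : set_val A = sdecode L z -> Mod_structure A = dec L z.
Proof. by rewrite /Mod_structure => ->. Qed.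

Lemma set_val_inj (A B : Mod T) : set_val A = set_val B -> A = B.
Proof. by move=> E; apply: val_inj. Qed.

End ModPoints.

(** * Uniform Borel bound on images under a faithful embedding *)

Section FaithfulEmbedding.
Context (LT LS : language) (T : sentence LT) (S : sentence LS).
Context (Phi : Mod T -> Mod S).
Context (embPhi : borel_embedding Phi) (faithPhi : faithful Phi).

(** Lifts Phi to all points, with a constant value off the codes of models of [T]; these codes form
    a Borel set, so the coordinates of the lift remain Borel. *)
Lemma Phi_code : exists F : baire -> baire,
  (forall k, bor_val (fun z => F z k)) /\
  forall (A : Mod T) z, set_val A = sdecode LT z ->
    set_val (Phi A) = sdecode LS (F z).
Proof.
have HY k : exists Y : nat -> baire -> Prop, forall m, bor (Y m) /\
    forall (A : Mod T) z, sdecode LT z = set_val A ->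
      (sencode (set_val (Phi A)) k = m <-> Y m z).
  have /choice[Y HY] m := borel_bor (embPhi.1 _ (@borel_encode LS S k m)).
  by exists Y.
have /choice[Y {}HY] := HY.
pose F z : baire := match pselect (exists A : Mod T, set_val A = sdecode LT z) with
  | left H => sencode (set_val (Phi (sval (cid H))))
  | right _ => fun=> 0
  end.
have FE A z : set_val A = sdecode LT z -> F z = sencode (set_val (Phi A)).
  rewrite /F; case: pselect => [H E|N E]; last by case: N; exists A.
  case: cid => A' /= E'; congr (sencode (set_val (Phi _))).
  by apply: set_val_inj; rewrite E.
exists F; split; last by move=> A z /FE->; rewrite sencodeK.
move=> k m; have bT : bor (fun z => models (dec LT z) T) by apply: bor_models.
have : bor (fun z => (models (dec LT z) T /\ Y k m z) \/ (~ models (dec LT z) T /\ 0 = m)).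
  apply: bor_or; apply: bor_and => //; last exact: bor_const.
    by have [] := HY k m.
  exact: bor_not.
apply: bor_ext => z; have [/Mod_exists[A E]|N] := EM (models (dec LT z) T).
  have Tz : models (dec LT z) T by rewrite -(Mod_dec E); apply: Mod_models.
  rewrite (FE A) //; have [_ /(_ A z (esym E)) ->] := HY k m.
  by split=> [[[]|[]]//|]; left.
have -> : F z = fun=> 0.
  rewrite /F; case: pselect => // -[A E]; case: N.
  by rewrite -(Mod_dec E); apply: Mod_models.
by split=> [[[]|[]]//|]; right.
Qed.

Lemma image_bor : exists Y, bor Y /\
  forall z, models (dec LS z) S ->
    (Y z <-> exists A : Mod T, isomorphic (Mod_structure (Phi A)) (dec LS z)).
Proof.
have [Y [bY HY]] := borel_bor (faithPhi (@borelT (Mod T))).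
exists Y; split=> // z /Mod_exists[B E].
rewrite -(HY B) // /iso_closure /= /Mod_iso (Mod_dec E).
by split=> [[_ [A _ <-]]|[A AB]]; [exists A|exists (Phi A) => //; exists A].
Qed.

Definition image_of (F : baire -> baire) (c : bcode) (a z : baire) : Prop :=
  [/\ models (dec LT a) T, force LT a c [::] &
      isomorphic (dec LS (F a)) (dec LS z)].

Context (F : baire -> baire) (borF : forall k, bor_val (fun z => F z k)).
Context (codeF : forall (A : Mod T) z, set_val A = sdecode LT z ->
  set_val (Phi A) = sdecode LS (F z)).

Lemma Phi_dec (A : Mod T) a : set_val A = sdecode LT a ->
  Mod_structure (Phi A) = dec LS (F a).
Proof. by move=> E; apply: Mod_dec; apply: codeF. Qed.

Lemma code_models a : models (dec LT a) T -> models (dec LS (F a)) S.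
Proof. by move=> /Mod_exists[A /Phi_dec <-]; apply: Mod_models. Qed.

Lemma code_iso a a' : models (dec LT a) T -> models (dec LT a') T ->
  (isomorphic (dec LS (F a)) (dec LS (F a')) <-> isomorphic (dec LT a) (dec LT a')).
Proof.
move=> /Mod_exists[A E] /Mod_exists[A' E'].
rewrite -(Phi_dec E) -(Phi_dec E') -(Mod_dec E) -(Mod_dec E').
exact: iff_sym (embPhi.2 A A').
Qed.

(** Fixing [x] turns a basic set into a constant, of rank at most 3, or into a basic set in [z]; the
    bound is the same for every [x]. *)
Lemma bor_slice W : bor W ->
  exists b, forall x, borel_rank b (fun z => W (bpair x z)).
Proof.
move=> [b HW]; exists (oadd (onat 3) b) => x; apply: borel_rank_comp HW => k m.
rewrite /bpair /join; case: unpickle => [[[|i] n]|].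
- exact: borel_rank_const.
- apply: (@borel_rank_le OZero) => //.
  by exists (Bbasic n m).
- exact: borel_rank_const.
Qed.

(** [P] and [Q] are projections of Borel sets and complementary on pairs, so a Borel separator
    coincides there with [P], and its slices share a rank. *)
Lemma image_rank a0 : exists b, forall x,
  borel_rank b (fun z => exists a, image_of F (code_of a0 x) a z).
Proof.
have [Y [bY HY]] := image_bor.
(* A point [u] packs ((x, z), w): [row 0 u] holds the parameter x and the point z, and the rows of w
   = [row 1 u] are a code of a model, an isomorphism and its inverse. *)
pose graph (u : baire) := iso_graph LS (row 1 (row 1 u)) (row 2 (row 1 u))
  (F (row 0 (row 1 u))) (row 1 (row 0 u)).
pose inT (u : baire) := models (dec LT (row 0 (row 1 u))) T.
pose inC (u : baire) :=
  force LT (row 0 (row 1 u)) (code_of a0 (row 0 (row 0 u))) [::].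
pose inY (u : baire) :=
  models (dec LS (row 1 (row 0 u))) S /\ Y (row 1 (row 0 u)).
have coord i j k : bor_val (fun u => row i (row j u) k) by move=> m; apply: bor_basic.
have bgraph : bor graph.
  apply: bor_iso_graph; do ?exact: coord.
  by move=> k; apply: (@bor_val_comp (fun z => F z k)) => // k'; apply: coord.
have binT : bor inT by apply: bor_comp (bor_models T) => k; apply: coord.
have binC : bor inC by apply: bor_force => k; apply: coord.
have binY : bor inY.
  by apply: (@bor_comp (fun z => models (dec LS z) S /\ Y z)) => [k|];
    [apply: coord|apply: bor_and => //; apply: bor_models].
pose P (v : baire) := exists w, (fun u => inT u /\ inC u /\ graph u) (bpair v w).
pose Q (v : baire) := exists w,
  (fun u => ~ inY u \/ inT u /\ ~ inC u /\ graph u) (bpair v w).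
have aP : analytic P.
  by apply: analytic_proj; apply: bor_analytic; do ?apply: bor_and.
have aQ : analytic Q.
  apply: analytic_proj; apply: bor_analytic; apply: bor_or; first exact: bor_not.
  by apply: bor_and => //; apply: bor_and => //; apply: bor_not.
have row0 v w : row 0 (bpair v w) = v by rewrite row_join.
have row1 v w : row 1 (bpair v w) = w by rewrite row_join.
have PE x z : P (bpair x z) <-> exists a, image_of F (code_of a0 x) a z.
  rewrite /P /inT /inC /graph; split=> [[w]|[a [aT aC /iso_graphP[h [h' hh']]]]].
    rewrite !row0 !row1 => -[wT [wC wg]]; exists (row 0 w); split=> //.
    by apply/iso_graphP; exists (row 1 w), (row 2 w).
  exists (join (fun i => if i is i'.+1 then if i' is 0 then h else h' else a)).
  by rewrite !row0 !row1 !row_join.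
have QE x z : Q (bpair x z) <-> ~ (models (dec LS z) S /\ Y z) \/
    exists a, [/\ models (dec LT a) T, ~ force LT a (code_of a0 x) [::] &
      isomorphic (dec LS (F a)) (dec LS z)].
  rewrite /Q /inT /inC /graph /inY; split=> [[w]|[nY|[a [aT aC /iso_graphP[h [h' hh']]]]]].
  - rewrite !row0 !row1 => -[|[wT [wC wg]]]; first by left.
    right; exists (row 0 w); split=> //.
    by apply/iso_graphP; exists (row 1 w), (row 2 w).
  - by exists z; left; rewrite !row0 !row1.
  - exists (join (fun i => if i is i'.+1 then if i' is 0 then h else h' else a)).
    by right; rewrite !row0 !row1 !row_join.
(* A point need not be of the form [bpair x z], but [P] and [Q] look only at its rows 0 and 1. *)
have pairE v : exists x z, forall U : baire -> Prop,
    (U = P \/ U = Q) -> (U v <-> U (bpair x z)).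
  exists (row 0 v), (row 1 v) => U [] ->.
    by rewrite /P /inT /inC /graph; split=> -[w]; rewrite !row0 !row1 => H;
      exists w; rewrite !row0 !row1.
  by rewrite /Q /inT /inC /inY /graph; split=> -[w]; rewrite !row0 !row1 => H;
      exists w; rewrite !row0 !row1.
have disj v : P v -> Q v -> False.
  have [x [z E]] := pairE v; rewrite (E P (or_introl erefl)) (E Q (or_intror erefl)).
  rewrite PE QE => -[a [aT aC az]] [[]|[a' [a'T a'C a'z]]].
    have zS : models (dec LS z) S by apply/(models_iso S az)/code_models.
    split=> //; apply/(HY z zS); have [A EA] := Mod_exists aT.
    by exists A; rewrite (Phi_dec EA).
  apply: a'C; apply: force_iso aC; apply/(code_iso aT a'T).
  exact: isomorphic_trans az (isomorphic_sym a'z).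
have [W [bW PW QW]] := analytic_separation aP aQ disj.
have [b Hb] := bor_slice bW; exists b => x; apply: borel_rank_ext (Hb x) => z.
split=> [Wz|/PE/PW//].
have nQ : ~ Q (bpair x z) by move=> /QW.
have [zS zY] : models (dec LS z) S /\ Y z.
  by apply: contrapT => N; apply: nQ; apply/QE; left.
have [A Az] := (HY z zS).1 zY.
pose a := sencode (set_val A); have Ea : set_val A = sdecode LT a by rewrite sencodeK.
have aT : models (dec LT a) T by rewrite -(Mod_dec Ea); apply: Mod_models.
have az : isomorphic (dec LS (F a)) (dec LS z) by rewrite -(Phi_dec Ea).
exists a; split=> //; apply: contrapT => nC; apply: nQ; apply/QE; right.
by exists a.
Qed.

End FaithfulEmbedding.

(** * Transfer of bounded gaps *)

Lemma models_all_le (L : language) (I : countType) b (c : I -> ord)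
    (phi : I -> sentence L) :
  (forall i, ole (c i) b) -> (forall i, is_Pi (c i) (phi i)) ->
  exists2 psi : sentence L, is_Pi (osucc (osucc b)) psi &
    forall M : structure L, models M psi <-> forall i, models M (phi i).
Proof.
move=> cb H.
have [psi Ppsi E] := @pi_def_all_le L (structure L) id I b 0 c
  (fun i M e => sat (phi i) e) cb
  (fun i => ex_intro2 _ _ (phi i) (H i) (fun _ _ => iff_refl _)).
by exists psi => // M; apply: E.
Qed.

(** The sentence supplied by [lopez_escobar] is correct on decoded structures, and the axiom of
    level 2 excludes finite ones; conjoining the two costs two successors. *)
Lemma scott_sentence_dec (L : language) b (X : baire -> Prop) a :
  borel_rank b X -> (forall z, X z <-> isomorphic (dec L a) (dec L z)) ->
  has_Pi_scott_sentence (dec L a)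
    (osucc (osucc (omax (oadd (onat 1) b) (onat 2)))).
Proof.
move=> HX XE; have [|d [phi [db Pphi Hphi]]] := @lopez_escobar L b X HX.
  by move=> z z' zz' /XE az; apply/XE; apply: isomorphic_trans zz'.
have [inf Pinf Hinf] := infinite_axiom L.
pose ob (i : bool) := if i then d else onat 2.
pose fb (i : bool) := if i then phi else inf.
have [||psi Ppsi Hpsi] := @models_all_le L bool (omax (oadd (onat 1) b) (onat 2)) ob fb.
- by case; [apply: ole_trans db (ole_maxl _ _)|apply: ole_maxr].
- by case.
exists psi => // N cN; rewrite Hpsi; split=> [H|aN].
  have iN := infinite_axiom_infinite ((Hinf N).1 (H false)).
  have [z zN] := infinite_iso_dec cN iN.
  apply: (isomorphic_trans _ zN); apply/XE/Hphi.
  exact/(models_iso phi zN)/(H true).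
case; last by apply/(models_iso inf aN)/Hinf; apply: infinite_axiom_dec.
by apply/(models_iso phi aN)/Hphi/XE; apply: isomorphic_refl.
Qed.

(** Asks for some Scott sentence of bounded level instead of the exact rank, which [ord_min]
    recovers afterwards. *)
Definition gap_bound (L : language) (T : sentence L) (a d : ord) : Prop :=
  forall T' : sentence L, is_Pi a T' -> entails T' T -> satisfiable T' ->
  exists M : structure L, [/\ countable_structure M, models M T' &
    exists2 c, has_Pi_scott_sentence M (osucc c) & ole c d].

Lemma bounded_gapsP (L : language) (T : sentence L) :
  (forall a, exists d, gap_bound T a d) -> bounded_scott_spectral_gaps T.
Proof.
move=> H; pose pick (P : ord -> Prop) : ord :=
  if pselect (exists d, P d) is left ex then sval (cid ex) else OZero.
exists (fun a => pick (gap_bound T a)); split=> [a b ab|a T' PT' T'T sT'].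
  (* For equal ordinals the predicates are equal by extensionality, so choice returns literally the
     same bound. *)
  suff -> : gap_bound T a = gap_bound T b by split; apply: ole_refl.
  apply/funext => d; apply/propext; split=> G T' /is_Pi_oeq PT'.
    by apply: G; apply: PT'; split; [apply: ab.2|apply: ab.1].
  by apply: G; apply: PT'.
rewrite /pick; case: pselect => [ex|/(_ (H a))//]; case: cid => d /= G.
have [M [cM MT' [c Hc cd]]] := G T' PT' T'T sT'.
have [c0 Hc0 min] := @ord_min (fun c => has_Pi_scott_sentence M (osucc c)) c Hc.
exists M; split=> //; exists c0; first by split.
by apply: ole_trans (min c Hc) cd.
Qed.

(** Uniformity lies in the order of choices: every ordinal is fixed before T' appears. [a1] bounds
    codes of Pi_a classes, [b0] the closures of their images, [b] the level of the axiomatisation,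
    [b2] the classes of Scott sentences up to level D(b) + 1, and [b3] their pullbacks. *)
Lemma gap_bound_transfer (LT LS : language) (T : sentence LT) (S : sentence LS)
    (Phi : Mod T -> Mod S) :
  borel_embedding Phi -> faithful Phi -> bounded_scott_spectral_gaps S ->
  forall a, exists d, gap_bound T a d.
Proof.
move=> embPhi faithPhi [D [_ HD]] a.
have [F [borF codeF]] := Phi_code embPhi.
have [r Hr] := bor_coord_rank borF.
have [t Ht] := bor_models T.
have [a1 Ha1] := sat_rank LT a.
have [b0 Hb0] := image_rank embPhi faithPhi borF codeF a1.
have [s [S0 [PS0 HS0]]] := is_Pi_normal_form S.
have [inf Pinf Hinf] := infinite_axiom LS.
pose b1 := omax (oadd (onat 1) b0) (omax s (onat 2)).
pose b := osucc (osucc b1).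
have [b2 Hb2] := sat_rank LS (osucc (D b)).
pose b3 := osucc (osucc (omax (onat 3) (omax t (oadd r b2)))).
pose d := osucc (omax (oadd (onat 1) b3) (onat 2)).
exists (omax (onat 2) d) => T' PT' T'T /satisfiable_countable[M cM MT'].
have [fM|iM] := EM (finite_set [set: M]).
  exists M; split=> //; exists (onat 2); last exact: ole_maxl.
  exact: finite_scott_sentence.
have [a0 a0M] := infinite_iso_dec cM iM.
pose e0 (i : 'I_0) : nat := match notF (ltn_ord i) with end.
have [c ca1 cT'] : borel_rank a1 (fun z => models (dec LT z) T').
  have := Ha1 a 0 T' (ole_refl a) (or_introl PT') e0.
  by apply: borel_rank_ext => z; rewrite -modelsE.
have [x xc] := code_of_surj ca1.
have forceT' z : force LT z c [::] <-> models (dec LT z) T'.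
  rewrite -cT'; apply: force_invariant => g g' gK g'K; rewrite !cT'.
  exact: models_iso (pull_iso (M := dec LT z) gK g'K).
have imE z : (exists y, image_of LS T F (code_of a1 x) y z) <->
    exists2 y, models (dec LT y) T' & isomorphic (dec LS (F y)) (dec LS z).
  rewrite xc; split=> [[y [yT /forceT' yT' yz]]|[y yT' yz]]; first by exists y.
  by exists y; split=> //; [apply: T'T|apply/forceT'].
have [|e [psi [eb Ppsi Hpsi]]] := @lopez_escobar LS b0 _ (Hb0 x).
  move=> z z' zz' /imE[y yT' yz]; apply/imE; exists y => //.
  exact: isomorphic_trans zz'.
(* Three conjuncts: [psi] axiomatises the closure on codes, [S0] ensures that S is entailed, and
   [inf] that countable models are coded. *)
pose os (i : option bool) := match i with
  | Some true => e | Some false => s | None => onat 2 end.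
pose fs (i : option bool) := match i with
  | Some true => psi | Some false => S0 | None => inf end.
have [||S' PS' HS'] := @models_all_le LS (option bool) b1 os fs.
- case=> [[]|]; first exact: ole_trans eb (ole_maxl _ _).
    exact: ole_trans (ole_maxl _ _) (ole_maxr _ _).
  exact: ole_trans (ole_maxr _ _) (ole_maxr _ _).
- by case=> [[]|].
have [||B [cB BS' [c0 [[theta Ptheta Htheta] _] c0D]]] := HD b S' PS'.
- by move=> N /HS' H; apply/HS0; apply: (H (Some false)).
- have a0T' : models (dec LT a0) T' by apply/(models_iso T' a0M).
  exists (dec LS (F a0)); apply/HS' => -[[]|] /=.
  + by apply/Hpsi/imE; exists a0 => //; apply: isomorphic_refl.
  + by apply/HS0; apply: (code_models codeF); apply: T'T.
  + by apply/Hinf; apply: infinite_axiom_dec.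
have iB := infinite_axiom_infinite ((Hinf B).1 ((HS' B).1 BS' None)).
have [z zB] := infinite_iso_dec cB iB.
have /Hpsi/imE[y yT' yz] : models (dec LS z) psi.
  by apply/(models_iso psi zB); apply: ((HS' B).1 BS' (Some true)).
have yT := T'T _ yT'.
have cdec L w : countable_structure (dec L w) by apply: countableP.
exists (dec LT y); split=> //; exists d; last exact: ole_maxr.
(* Nothing is known of [F] off the codes of models of T; the first conjunct excludes such points. *)
pose X u := models (dec LT u) T /\ models (dec LS (F u)) theta.
apply: (@scott_sentence_dec LT b3 X).
  have : borel_rank b3 (fun u => forall i : bool,
      (if i then models (dec LT u) T else models (dec LS (F u)) theta)).
    apply: borel_rank_forall_count; first exact: ole_maxl.
    move=> i; apply: (borel_rank_le (ole_maxr _ _)).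
    case: i; first exact: borel_rank_le (ole_maxl _ _) Ht.
    apply: borel_rank_le (ole_maxr _ _) _.
    apply: (@borel_rank_comp r b2 (fun v => models (dec LS v) theta)) => //.
    have := Hb2 (osucc c0) 0 theta (ole_succ c0D) (or_introl Ptheta) e0.
    by apply: borel_rank_ext => v; rewrite -modelsE.
  apply: borel_rank_ext => u; split=> [H|[? ?] []//].
  by split; [apply: (H true)|apply: (H false)].
have By : isomorphic (dec LS (F y)) B by apply: isomorphic_trans zB.
move=> u; split=> [[uT /(Htheta _ (cdec _ _)) Bu]|yu].
  by apply/(code_iso embPhi codeF yT uT); apply: isomorphic_trans Bu.
have uT : models (dec LT u) T by apply/(models_iso T yu).
split=> //; apply/(Htheta _ (cdec _ _)).
apply: isomorphic_trans (isomorphic_sym By) _.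
exact/(code_iso embPhi codeF yT uT).
Qed.

Theorem theorem8p2 (LT LS : language) (T : sentence LT) (S : sentence LS)
    (Phi : Mod T -> Mod S) :
  borel_embedding Phi -> faithful Phi ->
  unbounded_scott_spectral_gaps T -> unbounded_scott_spectral_gaps S.
Proof.
move=> embPhi faithPhi unbT bS; apply: unbT; apply: bounded_gapsP.
exact: gap_bound_transfer embPhi faithPhi bS.
Qed.
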